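(* The star $K_{1,4}$ of order $5$ is the only integral tree with nullity $3$.
   Context: Eigenvalues of a graph are those of its adjacency matrix. A graph is integral if all its eigenvalues are integers. The nullity of a graph is the multiplicity of $0$ as an eigenvalue of its adjacency matrix. *)

(* Defs.v *)
From mathcomp Require Import all_boot all_order all_algebra all_field.

Set Implicit Arguments.
Unset Strict Implicit.
Unset Printing Implicit Defensive.

Import GRing.Theory Num.Theory.
Local Open Scope ring_scope.

Record sgraph := SGraph {
  vertex :> finType;
  adj : rel vertex;
  adj_sym : symmetric adj;
  adj_irrefl : irreflexive adj }.

Definition adjacency_matrix (G : sgraph) : 'M[algC]_#|G| :=
  \matrix_(i, j) (adj (enum_val i) (enum_val j))%:R.

Definition integral_graph (G : sgraph) : Prop :=
  forall a : algC, eigenvalue (adjacency_matrix G) a -> a \is a Num.int.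

Definition nullity (G : sgraph) : nat := mup 0 (char_poly (adjacency_matrix G)).

Definition connected_graph (G : sgraph) : Prop :=
  (0 < #|G|)%N /\ forall x y : G, connect (@adj G) x y.

(* [ucycle] also accepts the sequences [:: x; y] with x and y adjacent, which
   are not cycles of a simple graph: cycles have at least three vertices. *)
Definition acyclic_graph (G : sgraph) : Prop :=
  forall c : seq G, ucycle (@adj G) c -> (size c < 3)%N.

Definition is_tree (G : sgraph) : Prop := connected_graph G /\ acyclic_graph G.

Definition isomorphic (G H : sgraph) : Prop :=
  exists2 f : G -> H, bijective f & forall x y, adj (f x) (f y) = adj x y.

Definition bipartite_adj (m n : nat) : rel ('I_m + 'I_n) :=
  fun x y => match x, y with
             | inl _, inr _ | inr _, inl _ => true
             | _, _ => false
             end.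

Lemma bipartite_adj_sym m n : symmetric (@bipartite_adj m n).
Proof. by case=> i [] j. Qed.

Lemma bipartite_adj_irrefl m n : irreflexive (@bipartite_adj m n).
Proof. by case. Qed.

Definition complete_bipartite (m n : nat) : sgraph :=
  SGraph (@bipartite_adj_sym m n) (@bipartite_adj_irrefl m n).

(* Main.v *)
Require Import Defs.
From mathcomp Require Import all_boot all_order all_algebra all_field.
From mathcomp Require Import zify ring.

(** Let T be an integral tree with n vertices, adjacency matrix A and nullity 3,
    and let m be the multiplicity of the eigenvalue 1.  If an eigenvector for 1
    vanishes at v but not at a neighbour of v, deleting v raises the multiplicity
    of 1 (Parter).  Delete a largest set S of q vertices such that 1 has
    multiplicity at least m + q in T - S; then 1 has multiplicity at most one in
    every component of T - S.  The eigenvalues of T are 0, 1, -1 or of absolute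
    value at least 2, and deleting q vertices loses at most 2q eigenvalues of the
    last kind and does not increase the rank.  Counting dimensions, all these
    bounds are equalities: T - S has nullity 3 - q and the same rank as T, and its
    eigenvalues are again 0, 1, -1 or of absolute value at least 2.

    Comparing the trace of the square of its adjacency matrix with the number of
    edges of a forest bounds the number t of the latter: q + t <= 3 if q > 0.
    - If q = 0, then n = 5 and A^3 = 4 A, so T is the star.
    - If q > 0 and t = 0, the number of edges shows that T - S has isolated
      vertices unless q = 3, and since the rank does not drop they would be isolated
      in T.  For q = 3, T - S is a perfect matching, and the squares of the three
      eigenvalues at least 2 of T, minus 1, are the eigenvalues of the 3 x 3 matrix
      counting common neighbours of the vertices of S.  This matrix has
      off-diagonal entries 0 or 1, not all 0, while distinct eigenvalues differ by
      at least 5, which is impossible.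
    - If q = 1 and t = 2, the deleted vertex has degree d and T contains the
      subdivided star with d rays as a proper subgraph, so the largest eigenvalue
      has square greater than d + 1, contradicting the trace of A^2. *)

Set Implicit Arguments.
Unset Strict Implicit.
Unset Printing Implicit Defensive.

Import Order.TTheory GRing.Theory Num.Theory.
Local Open Scope ring_scope.
Local Open Scope sesquilinear_scope.

(** * Spectra of Hermitian matrices *)

Definition sqn n (x : 'rV[algC]_n) : algC := \sum_i `|x 0 i| ^+ 2.

Lemma sqnE n (x : 'rV[algC]_n) : sqn x = (x *m x^t*) 0 0.
Proof. by rewrite mxE; apply: eq_bigr => i _; rewrite !mxE normCK. Qed.

Lemma sqn_ge0 n (x : 'rV[algC]_n) : 0 <= sqn x.
Proof. by apply: sumr_ge0 => i _; rewrite exprn_ge0. Qed.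

Lemma sqn_eq0 n (x : 'rV[algC]_n) : (sqn x == 0) = (x == 0).
Proof.
apply/idP/eqP => [|->]; last by rewrite sqnE mul0mx mxE.
rewrite psumr_eq0 => [/allP x0|i _]; last by rewrite exprn_ge0.
apply/rowP => i; move: (x0 i (mem_index_enum _)).
by rewrite expf_eq0 /= normr_eq0 mxE => /eqP.
Qed.

Lemma sqn_unitary n (x : 'rV[algC]_n) (U : 'M_n) :
  U \is unitarymx -> sqn (x *m U) = sqn x.
Proof.
by move=> Uu; rewrite !sqnE trmx_mul map_mxM mulmxA (mulmxtVK x Uu).
Qed.

Lemma mulmx_diagE m n (x : 'M[algC]_(m, n)) (c : 'rV_n) i j :
  (x *m diag_mx c) i j = x i j * c 0 j.
Proof. by rewrite mul_mx_diag mxE. Qed.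

Definition indmx n (I : {set 'I_n}) : 'M[algC]_n :=
  diag_mx (\row_i (i \in I)%:R).

(** For the lower bound, the identity is the sum of a multiple of the matrix and a diagonal matrix
    supported on the zero entries. *)
Lemma rank_diag_mx n (c : 'rV[algC]_n) :
  \rank (diag_mx c) = #|[set i | c 0 i != 0]|.
Proof.
set I := [set i | _].
have rk_le (J : {set 'I_n}) (b : 'rV[algC]_n) : (forall i, i \notin J -> b 0 i = 0) ->
    (\rank (diag_mx b) <= #|J|)%N.
  move=> bJ; have -> : diag_mx b = (\sum_(i in J) b 0 i *: delta_mx i i)%R.
    apply/matrixP=> i j; rewrite summxE !mxE.
    have [<-|nij] := eqVneq i j; last first.
      rewrite big1 // => k _; rewrite !mxE.
      by have [<-|_] := eqVneq i k; rewrite ?[j == i]eq_sym ?(negPf nij) mulr0.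
    have [iJ|iJ] := boolP (i \in J).
      rewrite (bigD1 i) //= big1 ?addr0 ?mxE ?eqxx ?mulr1 ?mulr1n //.
      by move=> k /andP[_ ki]; rewrite !mxE eq_sym (negPf ki) mulr0.
    rewrite bJ // big1 ?mul0rn // => k kJ; rewrite !mxE.
    by have [ik|_] := eqVneq i k; rewrite ?mulr0 //; rewrite ik kJ in iJ.
  rewrite -sum1_card; elim/big_rec2: _ => [|i y M _ IH]; first by rewrite mxrank0.
  apply: leq_trans (mxrank_add _ _) _; rewrite leq_add //.
  by apply: leq_trans (mxrankS (scalemx_sub _ (submx_refl _))) _; rewrite mxrank_delta.
apply/eqP; rewrite eqn_leq rk_le; last by move=> i; rewrite inE negbK => /eqP.
have n_le : (n <= \rank (diag_mx c) + #|~: I|)%N.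
  rewrite -{1}(mxrank1 algC n).
  have -> : 1%:M = diag_mx c *m diag_mx (\row_i (c 0 i)^-1)
      + diag_mx (\row_i (i \in ~: I)%:R).
    rewrite mulmx_diag -diag_const_mx -raddfD; congr diag_mx; apply/rowP => i.
    rewrite !mxE !inE negbK.
    by have [->|c0] := eqVneq (c 0 i) 0; rewrite ?mul0r ?add0r // divff ?addr0.
  apply: leq_trans (mxrank_add _ _) (leq_add (mxrankM_maxl _ _) _).
  by apply: rk_le => i /negPf; rewrite mxE => ->.
have := cardsC I; rewrite card_ord => cI.
by rewrite -(leq_add2r #|~: I|) cI.
Qed.

Lemma rank_indmx n (I : {set 'I_n}) : \rank (indmx I) = #|I|.
Proof.
rewrite rank_diag_mx; apply: eq_card => i; rewrite inE mxE.
by case: (i \in I); rewrite ?oner_neq0 ?eqxx.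
Qed.

(** Restricting [x *m K] to the coordinates in [I] is injective on the row space of [W]. *)
Lemma rank_le_card_coords m n (W : 'M[algC]_(m, n)) (K : 'M_n) (I : {set 'I_n}) :
    (forall x : 'rV_n, (x <= W)%MS -> (forall i, i \in I -> (x *m K) 0 i = 0) ->
      x = 0) ->
  (\rank W <= #|I|)%N.
Proof.
move=> inj; rewrite -(mxrank_mul_ker W (K *m indmx I)).
have -> : (W :&: kermx (K *m indmx I))%MS = 0.
  apply/eqP; rewrite -submx0; apply/rV_subP => x; rewrite sub_capmx.
  case/andP => xW /sub_kermxP xK; suff -> : x = 0 by rewrite sub0mx.
  apply: inj => // i iI; have /rowP/(_ i) := xK.
  by rewrite mulmxA mulmx_diagE !mxE iI mulr1.
by rewrite mxrank0 addn0 mulmxA -(rank_indmx I) mxrankM_maxr.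
Qed.

Section Hermitian.

Variables (n : nat) (M : 'M[algC]_n).
Hypothesis M_herm : M \is hermsymmx.

Let U := spectralmx M.
Let d i := spectral_diag M 0 i.

Lemma spectralE : M = U^t* *m diag_mx (spectral_diag M) *m U.
Proof.
rewrite -invmx_unitary ?spectral_unitarymx //.
exact/orthomx_spectralP/hermitian_normalmx.
Qed.

Lemma spectral_real i : d i \is Num.real.
Proof. by have /mxOverP := hermitian_spectral_diag_real M_herm; apply. Qed.

Let UU : U *m U^t* = 1%:M.
Proof. exact/unitarymxP/spectral_unitarymx. Qed.

Let UV : U^t* *m U = 1%:M. Proof. exact: mulmx1C. Qed.

Lemma spectral_mul_coord (x : 'rV_n) i :
  (x *m M *m U^t*) 0 i = (x *m U^t*) 0 i * d i.
Proof. by rewrite {1}spectralE -!mulmxA UU mulmx1 mulmxA mulmx_diagE. Qed.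

Lemma spectral_sqn (x : 'rV_n) : sqn x = \sum_i `|(x *m U^t*) 0 i| ^+ 2.
Proof. by rewrite -(@sqn_unitary _ x (U^t*)) // trmxC_unitary spectral_unitarymx. Qed.

Lemma spectral_sqnM (x : 'rV_n) :
  sqn (x *m M) = \sum_i `|(x *m U^t*) 0 i| ^+ 2 * d i ^+ 2.
Proof.
rewrite spectral_sqn; apply: eq_bigr => i _.
by rewrite spectral_mul_coord normrM exprMn (real_normK (spectral_real i)).
Qed.

Lemma spectral_form (x : 'rV_n) :
  (x *m M *m x^t*) 0 0 = \sum_i `|(x *m U^t*) 0 i| ^+ 2 * d i.
Proof.
have -> : x^t* = U^t* *m (x *m U^t*)^t*.
  by rewrite -map_mxM -trmx_mul -mulmxA UV mulmx1.
rewrite mulmxA mxE.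
apply: eq_bigr => i _; rewrite spectral_mul_coord !mxE normCK.
ring.
Qed.

Lemma spectral_shift_rank a :
  (\rank (M - a%:M)%R + #|[set i | d i == a]| = n)%N.
Proof.
have -> : M - a%:M = U^t* *m diag_mx (\row_i (d i - a)) *m U.
  have -> : diag_mx (\row_i (d i - a)) = diag_mx (spectral_diag M) - a%:M.
    by rewrite -diag_const_mx -raddfB; congr diag_mx; apply/rowP => i; rewrite !mxE.
  by rewrite mulmxBr mulmxBl -spectralE scalar_mxC -mulmxA UV mulmx1.
rewrite mxrankMfree ?row_free_unit ?spectral_unit //.
rewrite (eqmxMfull (diag_mx _) (A := U^t*)); last first.
  by rewrite -invmx_unitary ?spectral_unitarymx // row_full_unit unitmx_inv spectral_unit.
rewrite rank_diag_mx -[RHS](card_ord n) -(cardsC [set i | d i == a]) addnC.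
by congr addn; apply: eq_card => i; rewrite !inE mxE subr_eq0.
Qed.

Lemma eigenspace_rank a : \rank (eigenspace M a) = #|[set i | d i == a]|.
Proof.
rewrite mxrank_ker; apply/eqP; rewrite -(eqn_add2l (\rank (M - a%:M)%R)).
by rewrite spectral_shift_rank subnKC ?rank_leq_row.
Qed.

Lemma eigenvalue_spectral a : reflect (exists i, d i = a) (eigenvalue M a).
Proof.
rewrite /eigenvalue -mxrank_eq0 eigenspace_rank cards_eq0.
apply: (iffP (set0Pn _)) => -[i]; first by rewrite inE => /eqP <-; exists i.
by move=> <-; exists i; rewrite inE.
Qed.

Lemma spectral_trace : \tr M = \sum_i d i.
Proof.
by rewrite spectralE mxtrace_mulC mulmxA UU mul1mx mxtrace_diag.
Qed.

Lemma spectral_sqr : M *m M = U^t* *m diag_mx (\row_i d i ^+ 2) *m U.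
Proof.
rewrite {1 2}spectralE !mulmxA -[_ *m U *m U^t*]mulmxA UU mulmx1.
rewrite -[_ *m diag_mx _ *m diag_mx _]mulmxA mulmx_diag.
by congr (_ *m diag_mx _ *m _); apply/rowP => i; rewrite !mxE.
Qed.

Lemma spectral_trace_sqr : \tr (M *m M) = \sum_i d i ^+ 2.
Proof.
rewrite spectral_sqr mxtrace_mulC mulmxA UU mul1mx mxtrace_diag.
by apply: eq_bigr => i _; rewrite mxE.
Qed.

Lemma spectral_cubic b : (forall i, d i ^+ 3 = b * d i) ->
  M *m M *m M = b *: M.
Proof.
move=> db; rewrite spectral_sqr {1 2}spectralE !mulmxA.
rewrite -[_ *m U *m U^t*]mulmxA UU mulmx1.
rewrite -[_ *m diag_mx _ *m diag_mx _]mulmxA mulmx_diag.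
rewrite scalemxAl scalemxAr -linearZ /=.
by congr (_ *m diag_mx _ *m _); apply/rowP => i; rewrite !mxE -exprSr.
Qed.

(** Links the algebraic multiplicity that defines nullity to the count of zero eigenvalues used in
    all later counts. *)
Lemma mup_char_poly_spectral :
  mup 0 (char_poly M) = #|[set i | d i == 0]|.
Proof.
have -> : char_poly M = \prod_(i < n) ('X - (d i)%:P).
  have Mdet : char_poly M = char_poly (diag_mx (spectral_diag M)).
    rewrite /char_poly /char_poly_mx.
    have UUp : map_mx polyC U *m map_mx polyC (U^t*) = 1%:M :> 'M[{poly algC}]_n.
      by rewrite -map_mxM UU map_mx1.
    rewrite [in LHS]spectralE !map_mxM.
    rewrite [X in \det (X - _) = _](_ : _ = map_mx polyC (U^t*) *m 'X%:M
      *m map_mx polyC U); last by rewrite scalar_mxC -mulmxA (mulmx1C UUp) mulmx1.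
    by rewrite -mulmxBl -mulmxBr !det_mulmx mulrC mulrA -det_mulmx UUp det1 mul1r.
  rewrite Mdet char_poly_trig; last first.
    by apply/is_trig_mxP => i j ij; rewrite mxE -val_eqE /= ltn_eqF.
  by apply: eq_bigr => i _; rewrite mxE eqxx.
rewrite -(big_map d predT (fun y => 'X - y%:P)) mu_prod_XsubC.
by rewrite count_map -sum1_count -sum1_card; apply: eq_bigl => i; rewrite /= inE.
Qed.

Lemma spectral_sqnM_le b : (forall i, d i ^+ 2 <= b) ->
  forall x : 'rV_n, sqn (x *m M) <= b * sqn x.
Proof.
move=> db x; rewrite spectral_sqnM spectral_sqn mulr_sumr.
by apply: ler_sum => i _; rewrite mulrC ler_wpM2r ?exprn_ge0.
Qed.

(** The span of the eigenvectors concerned. With the converse count below, this plays the part of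
    the min-max principle. *)
Lemma spectral_big_subspace :
  let I := [set i | 4 <= d i ^+ 2] in
  exists2 W : 'M[algC]_n, \rank W = #|I| &
    forall x : 'rV_n, (x <= W)%MS -> 4 * sqn x <= sqn (x *m M).
Proof.
move=> I; exists (indmx I *m U) => [|x /submxP[y ->]].
  by rewrite mxrankMfree ?rank_indmx // row_free_unit spectral_unit.
rewrite spectral_sqnM spectral_sqn mulr_sumr; apply: ler_sum => i _.
rewrite mulmxA -[_ *m U^t*]mulmxA UU mulmx1 mulmx_diagE mxE inE.
have [le4|_] := boolP (4 <= d i ^+ 2); last by rewrite mulr0 normr0 expr0n !(mulr0, mul0r).
by rewrite mulrC ler_wpM2l ?exprn_ge0.
Qed.

(** A nonzero vector orthogonal to all eigenvectors with [4 <= d i ^+ 2] is stretched by less than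
    2, so the coordinates along these eigenvectors are injective on [W]. *)
Lemma spectral_big_count m (W : 'M[algC]_(m, n)) :
    (forall x : 'rV_n, (x <= W)%MS -> 4 * sqn x <= sqn (x *m M)) ->
  (\rank W <= #|[set i | (4 <= d i ^+ 2)%R]|)%N.
Proof.
move=> W4; apply: (@rank_le_card_coords _ _ _ (U^t*)) => x xW x0.
have : sqn (x *m M) - 4 * sqn x = 0.
  apply/eqP; rewrite eq_le subr_ge0 W4 // andbT subr_le0.
  rewrite spectral_sqnM spectral_sqn mulr_sumr; apply: ler_sum => i _.
  have [iI|iI] := boolP (4 <= d i ^+ 2).
    by rewrite x0 ?inE // normr0 expr0n !(mulr0, mul0r).
  rewrite mulrC ler_wpM2r ?exprn_ge0 //; apply: ltW.
  by rewrite real_ltNge ?rpredX ?spectral_real // realn.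
rewrite spectral_sqnM spectral_sqn mulr_sumr -sumrB => /eqP.
rewrite -oppr_eq0 -sumrN => E; apply/eqP; rewrite -sqn_eq0 spectral_sqn.
apply/eqP; apply: big1 => i _; move: E; rewrite psumr_eq0.
  move/allP/(_ i (mem_index_enum _)); rewrite opprB /=.
  have [iI _|iI] := boolP (4 <= d i ^+ 2).
    by rewrite x0 ?inE // normr0 expr0n.
  rewrite [4 * _]mulrC -mulrBr mulf_eq0 => /orP[/eqP //|].
  by rewrite subr_eq0 => /eqP E; rewrite -E lexx in iI.
move=> {}i _; rewrite opprB subr_ge0.
have [iI|iI] := boolP (4 <= d i ^+ 2).
  by rewrite x0 ?inE // normr0 expr0n !(mulr0, mul0r).
rewrite [4 * _]mulrC ler_wpM2l ?exprn_ge0 //; apply: ltW.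
by rewrite real_ltNge ?rpredX ?spectral_real // realn.
Qed.

(** A diagonal entry is an average of the eigenvalues, with weights [w k] the squared moduli of the
    coordinates of a basis vector. *)
Lemma spectral_diag_entry_bounds i :
  (exists j, d j <= M i i) /\ (exists j, M i i <= d j).
Proof.
pose w k := `|(delta_mx (0 : 'I_1) i *m U^t*) 0 k| ^+ 2.
have w_ge0 k : 0 <= w k by rewrite exprn_ge0.
have Mii : M i i = \sum_k w k * d k.
  rewrite -spectral_form -rowE trmx_delta map_delta_mx -colE !mxE //.
have one : \sum_k w k = 1.
  rewrite -spectral_sqn sqnE trmx_delta map_delta_mx ?mul_delta_mx ?mxE ?eqxx //.
have Mreal : M i i \is Num.real.
  rewrite Mii rpred_sum // => k _.
  by rewrite rpredM ?spectral_real // rpredX ?normr_real.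
have sum0 : \sum_k w k * (d k - M i i) = 0.
  under eq_bigr do rewrite mulrBr.
  by rewrite sumrB -mulr_suml one mul1r -Mii subrr.
have no_w (c : 'I_n -> algC) : (forall k, 0 < c k) ->
    \sum_k w k * c k = 0 -> False.
  move=> c_gt0 /eqP; rewrite psumr_eq0; last first.
    by move=> k _; rewrite mulr_ge0 // ltW.
  move/allP=> wc0; have /eqP := one; rewrite big1 ?(eq_sym 0) ?oner_eq0 // => k _.
  have := wc0 k (mem_index_enum _).
  by rewrite /= mulf_eq0 [c k == 0]gt_eqF ?orbF // => /eqP.
split; apply/existsP; apply: contraT => /existsPn H; exfalso.
  apply: (no_w (fun k => d k - M i i)) => // k; rewrite subr_gt0.
  by rewrite real_ltNge ?spectral_real.
apply: (no_w (fun k => M i i - d k)) => [k|].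
  by rewrite subr_gt0 real_ltNge ?spectral_real.
apply/eqP; rewrite -oppr_eq0 -sumrN -[X in _ == X]sum0; apply/eqP.
by apply: eq_bigr => k _; rewrite -mulrN opprB.
Qed.

End Hermitian.

(** * Rooted trees *)

(** Encoding a tree by parents and heights replaces arguments on paths and cycles by induction from
    the root. *)
Definition rooted (T : finType) (e : rel T) (r : T) (p : T -> T) (h : T -> nat) :=
  [/\ h r = 0%N, forall v, v != r -> h v = (h (p v)).+1
    & forall v w, e v w = (v != r) && (p v == w) || (w != r) && (p w == v)].

Definition rootable (T : finType) (e : rel T) :=
  forall r, exists p h, rooted e r p h.

Section RootedExistence.

Variable G : sgraph.
Hypothesis G_tree : is_tree G.

Let rooted_on (r : G) (X : {set G}) (p : G -> G) (h : G -> nat) :=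
  [/\ r \in X, h r = 0%N,
      (forall v, v \in X -> v != r -> p v \in X /\ h v = (h (p v)).+1),
      (forall v w, v \in X -> w \in X ->
        adj v w = (v != r) && (p v == w) || (w != r) && (p w == v))
    & forall v w, v \in X -> w \in X ->
        connect [rel x y | [&& adj x y, x \in X & y \in X]] v w].

(* A vertex outside of X with two neighbours in X would close a cycle. *)
Let rooted_on_extend r X p h u w : rooted_on r X p h ->
  u \in X -> w \notin X -> adj u w ->
  exists p' h', rooted_on r (w |: X) p' h'.
Proof.
case=> rX h0 pX adjX conX uX wX uw.
have uniq_nb v : v \in X -> adj v w -> v = u.
  move=> vX vw; apply/eqP/negPn/negP => vu.
  have [s] := connectP (conX u v uX vX); case/shortenP => s' s'path s'uniq _ v_last.
  have s'X : all (mem X) s'.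
    elim: (s') (u) s'path {s'uniq v_last} => //= y s2 IH x /andP[/and3P[_ _ ->]].
    exact: IH.
  have s'adj : path (@adj G) u s' by apply: sub_path s'path => x y /and3P[].
  have := (proj2 G_tree) (w :: u :: s'); rewrite /ucycle /= rcons_path s'adj.
  rewrite -v_last vw [adj w u]adj_sym uw; rewrite [uniq s']lock /= in s'uniq *.
  rewrite -lock in s'uniq *; rewrite s'uniq inE negb_or andbT.
  have -> : w != u by apply: contraNneq wX => ->.
  have -> : w \notin s' by apply: contra wX => /(allP s'X).
  move/(_ isT); rewrite ltnS ltnS; case: (s') v_last => //= v_last.
  by rewrite v_last eqxx in vu.
have wNX v : v \in X -> (v == w) = false by move=> vX; apply: contraNF wX => /eqP<-.
exists (fun v => if v == w then u else p v), (fun v => if v == w then (h u).+1 else h v).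
split; first by rewrite !inE rX orbT.
- by rewrite wNX.
- move=> v; rewrite !inE; case: eqVneq => [_ _ _|_ /= vX vr].
    by rewrite uX orbT (wNX u).
  by have [pvX ->] := pX v vX vr; rewrite pvX orbT (wNX (p v)).
- move=> v v'; rewrite !inE.
  have adjw v2 : v2 \in X -> adj v2 w = (u == v2).
    move=> v2X; apply/idP/eqP => [|<- //]; by move/(uniq_nb _ v2X).
  have wr : w != r by apply: contraNneq wX => ->.
  have pw v2 : v2 \in X -> (v2 != r) && (p v2 == w) = false.
    move=> v2X; case: (eqVneq v2 r) => //= v2r; exact/wNX/(pX v2 v2X v2r).1.
  case: (eqVneq v w) => [->|vw] /=; case: (eqVneq v' w) => [->|v'w] //=.
  + by rewrite adj_irrefl (wNX u) // andbF.
  + by move=> _ v'X; rewrite adj_sym adjw // wr /= pw ?orbF.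
  + by move=> vX _; rewrite adjw // pw // wr.
  + by move=> vX v'X; rewrite adjX.
have sub v v' : v \in X -> v' \in X ->
    connect [rel x y | [&& adj x y, x \in w |: X & y \in w |: X]] v v'.
  move=> vX v'X; have := conX v v' vX v'X; apply: connect_sub => x y /and3P[xy xX yX].
  by apply: connect1; rewrite /= xy !inE xX yX !orbT.
have uwc : connect [rel x y | [&& adj x y, x \in w |: X & y \in w |: X]] u w.
  by apply: connect1; rewrite /= uw !inE uX eqxx orbT.
have wuc : connect [rel x y | [&& adj x y, x \in w |: X & y \in w |: X]] w u.
  by apply: connect1; rewrite /= adj_sym uw !inE uX eqxx orbT.
move=> v v' /setU1P[->|vX] /setU1P[->|v'X] //.
- exact: connect_trans wuc (sub _ _ uX v'X).
- exact: connect_trans (sub _ _ vX uX) uwc.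
- exact: sub.
Qed.

(** A rooted subtree grows from [r] one vertex at a time; by connectedness some edge leaves it until
    it fills the graph. *)
Lemma tree_rootable : rootable (@adj G).
Proof.
move=> r.
have ext k : (k < #|G|)%N -> exists (X : {set G}) p h, #|X| = k.+1 /\ rooted_on r X p h.
  elim: k => [_|k IH kG].
    exists [set r], id, (fun=> 0%N); rewrite cards1; split => //; split => //.
    - by rewrite inE.
    - by move=> v /set1P-> /eqP.
    - by move=> v w /set1P-> /set1P->; rewrite adj_irrefl eqxx.
    - by move=> v w /set1P-> /set1P->; rewrite connect0.
  have [X [p [h [cX Xp]]]] := IH (ltnW kG).
  have [[u w] /= /and3P[uX wX uw]|none] :=
      pickP [pred uw : G * G | [&& uw.1 \in X, uw.2 \notin X & adj uw.1 uw.2]].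
    have [p' [h' X'p]] := rooted_on_extend Xp uX wX uw.
    by exists (w |: X), p', h'; split => //; rewrite cardsU1 wX cX.
  have clX : closed (@adj G) (mem X).
    apply: intro_closed; first exact: sym_connect_sym (@adj_sym G).
    move=> x y xy xX; apply: contraFT (none (x, y)) => yX /=.
    by rewrite xX yX xy.
  have XT : X = setT.
    apply/setP => v; rewrite inE; have [rX _ _ _ _] := Xp.
    by rewrite -(closed_connect clX ((proj2 (proj1 G_tree)) r v)).
  by move: kG; rewrite -cX XT cardsT ltnn.
have G0 : (0 < #|G|)%N := proj1 (proj1 G_tree).
have [|X [p [h [cX [rX h0 pX adjX _]]]]] := ext #|G|.-1; first by rewrite prednK.
have XT v : v \in X.
  suff -> : X = setT by rewrite inE.
  by apply/eqP; rewrite eqEcard subsetT cardsT cX prednK ?leqnn.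
exists p, h; split => // v; last by move=> w; rewrite adjX.
by move=> vr; have [] := pX v (XT v) vr.
Qed.

End RootedExistence.

Lemma rootable_enum (T : finType) (e : rel T) : rootable e ->
  rootable (fun i j : 'I_#|T| => e (enum_val i) (enum_val j)).
Proof.
move=> er r; have [p [h [h0 hp ep]]] := er (enum_val r).
exists (fun i => enum_rank (p (enum_val i))), (fun i => h (enum_val i)).
split => // [v vr|v w].
  by rewrite enum_rankK hp // (inj_eq enum_val_inj).
rewrite ep !(inj_eq enum_val_inj) -!(inj_eq enum_val_inj (enum_rank _)).
by rewrite !enum_rankK.
Qed.

Section RootedFacts.

Variables (T : finType) (e : rel T).

Section OneRoot.

Variables (r : T) (p : T -> T) (h : T -> nat).
Hypothesis erp : rooted e r p h.

Lemma rooted_parent v : v != r -> e v (p v).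
Proof. by case: erp => _ _ ->; rewrite eqxx andbT => ->. Qed.

Lemma rooted_height_gt0 v : v != r -> (0 < h v)%N.
Proof. by case: erp => _ hp _ /hp ->. Qed.

Lemma rooted_sym : symmetric e.
Proof. by case: erp => _ _ ep v w; rewrite !ep orbC. Qed.

Lemma rooted_irrefl : irreflexive e.
Proof.
case: erp => _ hp ep v; rewrite ep orbb; apply/negP => /andP[vr /eqP pv].
by have := hp v vr; rewrite pv => /n_Sn.
Qed.

Lemma rooted_edge_height v w : e v w -> odd (h w) = ~~ odd (h v).
Proof.
by case: erp => _ hp ->; case/orP => /andP[+ /eqP <-] => /hp -> /=; rewrite ?negbK.
Qed.

Lemma rooted_root_nb v : e v r = (v != r) && (p v == r).
Proof. by case: erp => _ _ ->; rewrite eqxx /= orbF. Qed.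

Lemma rooted_edge_nat v w : (e v w : nat) =
  ((v != r) && (p v == w) + (w != r) && (p w == v))%N.
Proof.
case: erp => _ hp ep; rewrite ep.
have [/andP[vr /eqP pv]|] := boolP ((v != r) && _) => //=.
case: (boolP (_ && _)) => // /andP[wr /eqP pw].
by have := hp v vr; rewrite pv (hp w wr) pw; lia.
Qed.

Lemma rooted_ind (P : T -> Prop) :
  P r -> (forall v, v != r -> P (p v) -> P v) -> forall v, P v.
Proof.
case: erp => _ hp _ Pr Pp v.
elim: {v}(h v) {-2}v (erefl (h v)) => [|k IH] v hv.
  by case: (eqVneq v r) => [->//|/hp]; rewrite hv.
case: (eqVneq v r) => [->//|vr]; apply: Pp => //; apply: IH.
by have := hp v vr; rewrite hv => -[].
Qed.

End OneRoot.

Hypothesis er : rootable e.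

Lemma rootable_sym : symmetric e.
Proof. by move=> v w; have [p [h H]] := er v; rewrite (rooted_sym H). Qed.

Lemma rootable_irrefl : irreflexive e.
Proof. by move=> v; have [p [h H]] := er v; rewrite (rooted_irrefl H). Qed.

(** Rooted at [u], both [v] and [w] are children of the root, and no edge joins two children of the
    same vertex. *)
Lemma rootable_triangle_free u v w : e u v -> e v w -> e u w -> False.
Proof.
have [p [h H]] := er u; rewrite -(rooted_sym H) (rooted_root_nb H).
case: (H) => _ _ ep /andP[vu /eqP pv]; rewrite ep vu /= pv.
case: eqVneq => [<- _|uw /= /eqP pw]; first by rewrite rootable_irrefl.
by rewrite -(rooted_sym H) (rooted_root_nb H) pw (negPf vu) andbF.
Qed.

(** Rooted at [u], every common neighbour of [u] and [v] is the parent of [v]. *)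
Lemma rootable_common_nb u v a b :
  u != v -> e u a -> e v a -> e u b -> e v b -> a = b.
Proof.
have [p [h H]] := er u => uv; rewrite !(rooted_sym H u) !(rooted_root_nb H).
case: (H) => _ _ ep /andP[au /eqP pa] + /andP[bu /eqP pb]; rewrite !ep.
rewrite pa pb (negPf uv) !andbF !orbF.
by move=> /andP[_ /eqP <-] /andP[_ /eqP <-].
Qed.

(** Take for [D] the component of [w] once [v] is removed: rooted at [v], the vertices whose
    ancestor of height 1 is [w]. *)
Lemma rootable_branch v w : e v w -> exists D : {set T},
  [/\ w \in D, v \notin D, (forall a b, e a b -> a \in D -> b != v -> b \in D)
    & forall a, a \in D -> e a v -> a = w].
Proof.
have [p [h H]] := er v; rewrite -(rooted_sym H) (rooted_root_nb H).
case/andP => wv /eqP pw; have [h0 hp ep] := H.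
pose anc u := iter (h u).-1 p u.
have ancp u : u != v -> p u != v -> anc u = anc (p u).
  move=> uv puv; rewrite /anc (hp u uv) /=.
  by have := rooted_height_gt0 H puv; case: (h _) => // k _; rewrite iterSr.
have anc1 u : u != v -> p u = v -> anc u = u.
  by move=> uv pu; rewrite /anc (hp u uv) pu h0.
exists [set u | (u != v) && (anc u == w)]; split.
- by rewrite inE wv anc1 ?eqxx.
- by rewrite inE eqxx.
- move=> a b; rewrite ep !inE => /orP[]/andP[nv /eqP pE] /andP[av /eqP aw] bv;
    rewrite bv /=; subst.
    by rewrite -ancp // pE.
  by rewrite ancp // pE.
- move=> a; rewrite inE => /andP[av /eqP <-].
  by rewrite (rooted_root_nb H) av => /eqP /anc1 ->.
Qed.

End RootedFacts.

(** * Deleting vertices *)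

Definition adjm n (e : rel 'I_n) : 'M[algC]_n := \matrix_(i, j) (e i j)%:R.

Lemma adjm_tr n (e : rel 'I_n) : symmetric e -> (adjm e)^T = adjm e.
Proof. by move=> es; apply/matrixP => i j; rewrite !mxE es. Qed.

Lemma adjm_herm n (e : rel 'I_n) : symmetric e -> adjm e \is hermsymmx.
Proof.
move=> es; apply/is_hermitianmxP; rewrite expr0 scale1r adjm_tr //.
by apply/matrixP => i j; rewrite !mxE rmorph_nat.
Qed.

(* The vertices of S are kept as isolated vertices: each adds a zero eigenvalue. *)
Definition del n (e : rel 'I_n) (S : {set 'I_n}) : 'M[algC]_n :=
  adjm (fun i j => [&& e i j, i \notin S & j \notin S]).

Lemma delE n (e : rel 'I_n) (S : {set 'I_n}) :
  del e S = indmx (~: S) *m adjm e *m indmx (~: S).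
Proof.
apply/matrixP => i j; rewrite mulmx_diagE mul_diag_mx !mxE !inE.
by case: (e i j); case: (i \in S); case: (j \in S); rewrite /= ?(mulr0, mul0r, mulr1).
Qed.

Lemma del0 n (e : rel 'I_n) : del e set0 = adjm e.
Proof. by apply/matrixP => i j; rewrite !mxE !inE !andbT. Qed.

Lemma del_herm n (e : rel 'I_n) S : symmetric e -> del e S \is hermsymmx.
Proof. by move=> es; apply: adjm_herm => i j; rewrite es; congr andb; rewrite andbC. Qed.

Lemma indmxC n (S : {set 'I_n}) : indmx (~: S) = 1%:M - indmx S.
Proof.
rewrite -diag_const_mx -raddfB; congr diag_mx; apply/rowP => i; rewrite !mxE inE.
by case: (i \in S); rewrite ?subrr ?subr0.
Qed.

Lemma indmxM n (S R : {set 'I_n}) : indmx S *m indmx R = indmx (S :&: R).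
Proof.
rewrite mulmx_diag; congr diag_mx; apply/rowP => i; rewrite !mxE inE.
by case: (i \in S); rewrite ?mul1r ?mul0r.
Qed.

Definition sdiag n (M : 'M[algC]_n) i := spectral_diag M 0 i.

Definition bigset n (M : 'M[algC]_n) : {set 'I_n} := [set i | 4 <= sdiag M i ^+ 2].

Definition nbig n (M : 'M[algC]_n) : nat := #|bigset M|.

Lemma card_spectrum_classes (n : nat) (d : 'I_n -> algC) :
  (#|[set i | (d i == 0)%R]| + #|[set i | (d i == 1)%R]| + #|[set i | (d i == -1)%R]|
   + #|[set i | (4 <= d i ^+ 2)%R]|)%N
  = #|[set i | [|| d i == 0, d i == 1, d i == -1 | 4 <= d i ^+ 2]]|.
Proof.
have cE (P : pred 'I_n) : #|[set i | P i]| = (\sum_i P i)%N.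
  by rewrite -sum1dep_card big_mkcond; apply: eq_bigr => i _; case: (P i).
rewrite !cE -!big_split /=; apply: eq_bigr => i _.
have n1 : (-1 == 1 :> algC) = false.
  by rewrite -subr_eq0 -opprD oppr_eq0 -(natrD _ 1 1) pnatr_eq0.
have [->|_] := eqVneq (d i) 0.
  by rewrite expr0n [0 == 1]eq_sym oner_eq0 eq_sym oppr_eq0 oner_eq0 (lern0 _ 4).
have [->|_] := eqVneq (d i) 1; first by rewrite eq_sym n1 expr1n (ler_nat _ 4 1).
by have [->|_] := eqVneq (d i) (-1); first by rewrite sqrrN expr1n (ler_nat _ 4 1).
Qed.

Definition mult1 n (e : rel 'I_n) (S : {set 'I_n}) : nat :=
  \rank (eigenspace (del e S) 1).

Section Deletion.

Variables (n : nat) (e : rel 'I_n).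
Hypothesis er : rootable e.

Let A := adjm e.
Let m1 := mult1 e.

Lemma del_trace S : \tr (del e S) = 0.
Proof. by apply: big1 => i _; rewrite mxE (rootable_irrefl er). Qed.

Lemma eigen_del_supp S (x : 'rV_n) i : x *m del e S = x -> i \in S -> x 0 i = 0.
Proof.
move=> <- iS; rewrite mxE; apply: big1 => j _.
by rewrite mxE iS !andbF mulr0.
Qed.

(* y, the part of x on the branch at w, satisfies y (del S - 1) = x_w e_v.
   Hence e_v is in the image of del S - 1, every eigenvector for 1 vanishes
   at v, and y is a new eigenvector once v is deleted. *)
Lemma parter_deletion S v w (x : 'rV_n) : x *m del e S = x ->
    v \notin S -> w \notin S -> e v w -> x 0 v = 0 -> x 0 w != 0 ->
  (m1 S < m1 (v |: S))%N.
Proof.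
move=> xS vS wS vw xv xw.
have [D [wD vD Dcl Dv]] := rootable_branch er vw.
have es := rootable_sym er.
pose y : 'rV[algC]_n := \row_i ((i \in D)%:R * x 0 i).
have yv : y 0 v = 0 by rewrite mxE (negPf vD) mul0r.
have yS : y *m del e S = y + x 0 w *: delta_mx 0 v.
  apply/rowP => u; rewrite !mxE eqxx /=.
  have [uS|uS] := boolP (u \in S).
    rewrite (eigen_del_supp xS uS) (_ : u == v = false) ?mulr0 ?addr0; last first.
      by apply: contraNF vS => /eqP <-.
    by apply: big1 => j _; rewrite !mxE uS !andbF mulr0.
  have [uD|uD] := boolP (u \in D).
    rewrite mul1r (_ : u == v = false) ?mulr0 ?addr0; last first.
      by apply: contraNF vD => /eqP <-.
    rewrite -[in RHS]xS mxE; apply: eq_bigr => j _; rewrite !mxE.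
    have [ju|] := boolP (e j u); rewrite ?mulr0 //.
    have [->|jv] := eqVneq j v; first by rewrite xv mulr0.
    by rewrite (Dcl u j) ?mul1r // es.
  rewrite mul0r add0r; have [->|uv] := eqVneq u v; last first.
    rewrite mulr0; apply: big1 => j _; rewrite !mxE.
    have [jD|_] := boolP (j \in D); rewrite ?mul0r //.
    have [ju|_] := boolP (e j u); rewrite ?mulr0 //.
    by rewrite (Dcl j u) in uD.
  rewrite mulr1 (bigD1 w) //= !mxE wD es vw wS vS mul1r mulr1 big1 ?addr0 // => j jw.
  rewrite !mxE; have [jD|_] := boolP (j \in D); rewrite ?mul0r //.
  have [jv|_] := boolP (e j v); rewrite ?mulr0 //.
  by rewrite (Dv j jD jv) eqxx in jw.
have sym : (del e S)^T = del e S.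
  by apply: adjm_tr => i j; rewrite es; congr andb; rewrite andbC.
have Ev (z : 'rV_n) : z *m del e S = z -> z 0 v = 0.
  move=> zS; have : z *m (y *m del e S)^T = z *m y^T + x 0 w *: (z *m (delta_mx 0 v)^T).
    by rewrite yS linearD /= linearZ /= mulmxDr scalemxAr.
  rewrite trmx_mul sym mulmxA zS => /eqP; rewrite -subr_eq0 opprD addrA subrr.
  rewrite add0r oppr_eq0 trmx_delta -colE => /eqP/matrixP/(_ 0 0)/eqP.
  by rewrite !mxE mulf_eq0 (negPf xw) => /eqP.
(* On vectors vanishing at [v], deleting [v] only forgets the value of the image at [v]. *)
have ext (z : 'rV_n) : z 0 v = 0 -> z *m del e (v |: S) = z *m del e S *m indmx (~: [set v]).
  move=> zv; apply/rowP => i; rewrite mulmx_diagE !mxE !inE mulr_suml.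
  apply: eq_bigr => j _; rewrite !mxE !inE !negb_or.
  have [->|_] := eqVneq j v; first by rewrite zv !mul0r.
  by have [_|_] := eqVneq i v; rewrite /= ?andbF ?mulr0 ?mulr1.
have fixv (z : 'rV_n) : z 0 v = 0 -> z *m indmx (~: [set v]) = z.
  move=> zv; apply/rowP => i; rewrite mulmx_diagE !mxE !inE.
  by have [->|_] := eqVneq i v; rewrite ?zv ?mul0r ?mulr1.
have eigP R (z : 'rV_n) : reflect (z *m del e R = z) (z <= eigenspace (del e R) 1)%MS.
  by apply: (iffP eigenspaceP); rewrite scale1r.
apply: rank_ltmx; rewrite ltmxE; apply/andP; split.
  by apply/rV_subP => z /eigP zS; apply/eigP; rewrite ext ?zS ?fixv // Ev.
apply/negP => /rV_subP/(_ y) sub.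
have /sub/eigP : (y <= eigenspace (del e (v |: S)) 1)%MS.
  apply/eigP; rewrite ext // yS mulmxDl fixv // -scalemxAl.
  rewrite (_ : _ *m _ = 0) ?scaler0 ?addr0 //; apply/rowP => i.
  by rewrite mulmx_diagE !mxE !inE; case: (eqVneq i v); rewrite ?mulr0 ?andbF ?mul0r.
rewrite yS => /rowP/(_ v); rewrite !mxE (negPf vD) mul0r add0r !eqxx mulr1 => /eqP.
by rewrite (negPf xw).
Qed.

(** A tree is bipartite: conjugation by the signs [(-1) ^+ h i] negates the matrix. *)
Lemma del_rank_opp S a : \rank (del e S + a%:M)%R = \rank (del e S - a%:M)%R.
Proof.
have [/eqP n0|] := boolP (n == 0)%N.
  have rk0 (M : 'M[algC]_n) : \rank M = 0%N.
    by apply/eqP; rewrite -leqn0 -[X in (_ <= X)%N]n0 rank_leq_row.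
  by rewrite !rk0.
rewrite -lt0n => n0; have [p [h H]] := er (Ordinal n0).
pose s : 'M[algC]_n := diag_mx (\row_i (-1) ^+ h i).
have ss : s *m s = 1%:M.
  rewrite mulmx_diag -diag_const_mx; congr diag_mx; apply/rowP => i; rewrite !mxE.
  by rewrite -expr2 sqrr_sign.
have su : s \in unitmx by case/mulmx1_unit: ss.
have -> : del e S + a%:M = - (s *m (del e S - a%:M) *m s).
  rewrite mulmxBr mulmxBl opprB addrC [s *m a%:M]scalar_mxC -(mulmxA a%:M) ss mulmx1.
  congr (_ + _).
  apply/matrixP => i j; rewrite [RHS]mxE mulmx_diagE mul_diag_mx !mxE.
  have [ij|] := boolP (e i j); rewrite /= ?mulr0 ?mul0r ?oppr0 //.
  have := rooted_edge_height H ij; rewrite -(signr_odd _ (h i)) -(signr_odd _ (h j)).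
  by case: (odd (h i)) => ->; rewrite /= expr0 expr1 ?mulrN1 ?mulN1r ?mul1r ?mulr1 ?opprK.
by rewrite mxrank_opp mxrankMfree ?row_free_unit // (eqmxMfull _ (A := s)) ?row_full_unit.
Qed.

Lemma del_spectrum_opp S a :
  #|[set i | sdiag (del e S) i == - a]| = #|[set i | sdiag (del e S) i == a]|.
Proof.
have dh := del_herm S (rootable_sym er).
apply/eqP; rewrite -(eqn_add2l (\rank (del e S - a%:M)%R)) -{1}del_rank_opp.
rewrite spectral_shift_rank //.
by have := spectral_shift_rank dh (- a); rewrite raddfN /= opprK => ->.
Qed.

Lemma del_rank S : (\rank (del e S) <= \rank A)%N.
Proof. by rewrite delE; apply: leq_trans (mxrankM_maxl _ _) (mxrankM_maxr _ _). Qed.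

(** In the span of the big eigenvectors of [A], asking that [x] and [x *m A] vanish on [S] costs at
    most [#|S|] dimensions each, and for such [x] deleting [S] does not change [x *m A]. *)
Lemma del_big S : (nbig A <= nbig (del e S) + 2 * #|S|)%N.
Proof.
have Ah := adjm_herm (rootable_sym er).
have [W rW W4] := spectral_big_subspace Ah.
pose W1 := (W :&: kermx (indmx S))%MS.
pose W2 := (W1 :&: kermx (A *m indmx S))%MS.
have rk1 : (\rank W <= #|S| + \rank W1)%N.
  by rewrite -(mxrank_mul_ker W (indmx S)) leq_add2r -(rank_indmx S) mxrankM_maxr.
have rk2 : (\rank W1 <= #|S| + \rank W2)%N.
  rewrite -(mxrank_mul_ker W1 (A *m indmx S)) leq_add2r -(rank_indmx S) mulmxA.
  exact: mxrankM_maxr.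
have rk3 : (\rank W2 <= nbig (del e S))%N.
  apply: spectral_big_count; first exact: del_herm (rootable_sym er).
  move=> x; rewrite !sub_capmx => /andP[/andP[xW /sub_kermxP xS] /sub_kermxP xAS].
  suff -> : x *m del e S = x *m A by apply: W4.
  rewrite delE !mulmxA !indmxC [x *m (_ - _)]mulmxBr mulmx1 xS subr0.
  by rewrite mulmxBr mulmx1 -mulmxA xAS subr0.
have rW' : \rank W = nbig A by [].
by lia.
Qed.

Section Equality.

Hypothesis A_int : forall a, eigenvalue A a -> a \is a Num.int.

Let k := #|[set i | sdiag A i == 0]|.

Let Ah : A \is hermsymmx. Proof. exact: adjm_herm (rootable_sym er). Qed.

Lemma integral_spectrum_classes i :
  [|| sdiag A i == 0, sdiag A i == 1, sdiag A i == -1 | 4 <= sdiag A i ^+ 2].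
Proof.
have : sdiag A i \is a Num.int by apply: A_int; apply/eigenvalue_spectral => //; exists i.
case/intrP => z ->.
have : [|| z == 0, z == 1, z == -1 | 4 <= z ^+ 2] by lia.
case/or4P => [/eqP->|/eqP->|/eqP->|z4]; rewrite ?eqxx ?orbT //.
by rewrite -rmorphXn /= (_ : 4 = 4%:~R) // ler_int z4 !orbT.
Qed.

Variable S : {set 'I_n}.
Hypothesis S_parter : (m1 set0 + #|S| <= m1 S)%N.

Let Sh : del e S \is hermsymmx. Proof. exact: del_herm (rootable_sym er). Qed.

(** The classes 0, 1, -1 and big exhaust the [n] eigenvalues of [A]. After the deletion the zeros do
    not decrease, 1 and -1 together gain at least [2 * #|S|], and the big ones lose at most as many.
    The classes thus again hold [n] eigenvalues and no inequality is strict. *)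
Lemma del_equality :
  [/\ #|[set i | sdiag (del e S) i == 0]| = k,
      m1 S = (m1 set0 + #|S|)%N,
      (nbig (del e S) + 2 * #|S|)%N = nbig A,
      n = (k + 2 * m1 S + nbig (del e S))%N
    & forall i, [|| sdiag (del e S) i == 0, sdiag (del e S) i == 1,
        sdiag (del e S) i == -1 | 4 <= sdiag (del e S) i ^+ 2]].
Proof.
have := card_spectrum_classes (sdiag A); have := card_spectrum_classes (sdiag (del e S)).
have -> : [set i | [|| sdiag A i == 0, sdiag A i == 1, sdiag A i == -1
    | 4 <= sdiag A i ^+ 2]] = setT.
  by apply/setP => i; rewrite !inE integral_spectrum_classes.
rewrite cardsT card_ord -!/(bigset _) -!/(nbig _) -/k.
have e1 := eigenspace_rank Sh 1; rewrite -!/(sdiag _ _) in e1.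
have e2 : m1 set0 = #|[set i | sdiag A i == 1]|.
  by rewrite /m1 /mult1 del0 (eigenspace_rank Ah).
have e3 := del_spectrum_opp S 1.
have e4 : #|[set i | sdiag A i == -1]| = #|[set i | sdiag A i == 1]|.
  by have := del_spectrum_opp set0 1; rewrite del0.
have e5 : (k <= #|[set i | (sdiag (del e S) i == 0)%R]|)%N.
  have A0 : (\rank A + k = n)%N.
    by have := spectral_shift_rank Ah 0; rewrite raddf0 subr0.
  have S0 : (\rank (del e S) + #|[set i | (sdiag (del e S) i == 0)%R]| = n)%N.
    by have := spectral_shift_rank Sh 0; rewrite raddf0 subr0.
  by have := del_rank S; lia.
set X := [set i | _ || _].
have Xn : (#|X| <= n)%N by rewrite -[X in (_ <= X)%N](card_ord n) max_card.
have := del_big S; rewrite e4 -e2 e3 -e1 -/(mult1 e S) -/(m1 S) => db E1 E2.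
have arith (z0 z m0 mS q t t' x : nat) : (z <= z0)%N -> (m0 + q <= mS)%N ->
    (t <= t' + 2 * q)%N -> (z0 + mS + mS + t')%N = x ->
    (z + m0 + m0 + t)%N = n -> (x <= n)%N ->
    [/\ z0 = z, mS = m0 + q, t' + 2 * q = t, n = z + 2 * mS + t' & x = n]%N.
  by move=> *; split; lia.
have [z0E mE tE nE Xn'] := arith _ _ _ _ _ _ _ _ e5 S_parter db E1 E2 Xn.
split => //.
move=> i; suff : i \in X by rewrite inE.
suff -> : X = setT by [].
by apply/eqP; rewrite eqEcard subsetT cardsT card_ord Xn' leqnn.
Qed.

Lemma del_sum_big (f : algC -> algC) : f 0 = 0 ->
  \sum_i f (sdiag (del e S) i) =
    (f 1 + f (-1)) *+ m1 S + \sum_(i in bigset (del e S)) f (sdiag (del e S) i).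
Proof.
move=> f0; have [_ _ _ _ cl] := del_equality.
set d := sdiag _ in cl *.
have -> : (f 1 + f (-1)) *+ m1 S =
    \sum_(i | d i == 1) f (d i) + \sum_(i | d i == -1) f (d i).
  rewrite (eq_bigr (fun=> f 1)) => [|i /eqP-> //].
  rewrite [X in _ = _ + X](eq_bigr (fun=> f (-1))) => [|i /eqP-> //].
  rewrite !sumr_const mulrnDl; congr (_ *+ _ + _ *+ _).
    by rewrite /m1 /mult1 (eigenspace_rank Sh) cardsE.
  rewrite /m1 /mult1 (eigenspace_rank Sh) -[LHS]/(#|[set i | d i == 1]|) -del_spectrum_opp.
  by rewrite cardsE.
rewrite !(big_mkcond (fun i => _ == _)) (big_mkcond (fun i => i \in _)) -!big_split /=.
apply: eq_bigr => i _; rewrite inE -/(d i).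
have n1 : (-1 == 1 :> algC) = false.
  by rewrite -subr_eq0 -opprD oppr_eq0 -(natrD _ 1 1) pnatr_eq0.
case/or4P: (cl i) => [/eqP->|/eqP->|/eqP->|d4].
- rewrite f0 expr0n [0 == 1]eq_sym oner_eq0 eq_sym oppr_eq0 oner_eq0.
  by rewrite (lern0 _ 4) !addr0.
- by rewrite eq_sym n1 eqxx expr1n (ler_nat _ 4 1) !addr0.
- by rewrite n1 eqxx sqrrN expr1n (ler_nat _ 4 1) addr0 add0r.
rewrite d4; have [d1|_] := eqVneq (d i) 1.
  by move: d4; rewrite d1 expr1n (ler_nat _ 4 1).
have [d1|_] := eqVneq (d i) (-1); last by rewrite !add0r.
by move: d4; rewrite d1 sqrrN expr1n (ler_nat _ 4 1).
Qed.

End Equality.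

Lemma del_trace_sqr S : \tr (del e S *m del e S) =
  (\sum_i \sum_j [&& e i j, i \notin S & j \notin S])%:R.
Proof.
rewrite /mxtrace natr_sum; apply: eq_bigr => i _; rewrite mxE natr_sum.
apply: eq_bigr => j _; rewrite !mxE (rootable_sym er j) -natrM; congr _%:R.
by case: (e i j); case: (i \in S); case: (j \in S).
Qed.

Section Tops.

Variables (r : 'I_n) (p : 'I_n -> 'I_n) (h : 'I_n -> nat).
Hypothesis erp : rooted e r p h.
Variable S : {set 'I_n}.

(* One vertex in each component of the forest left after deleting S. *)
Definition tops := [set v | (v \notin S) && ((v == r) || (p v \in S))].

(** A forest has as many edges as vertices minus components: each vertex outside [S] and [tops] owns
    the edge to its parent. *)
Lemma forest_edge_count :
  (\sum_i \sum_j [&& e i j, i \notin S & j \notin S] + 2 * (#|S| + #|tops|) = 2 * n)%N.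
Proof.
pose c := (\sum_(i | i \notin S) ((i != r) && (p i \notin S)))%N.
have -> : (\sum_i \sum_j [&& e i j, i \notin S & j \notin S] = c + c)%N.
  have cE : c = (\sum_i \sum_j ([&& i != r, p i == j, i \notin S & j \notin S] : nat))%N.
    rewrite /c big_mkcond; apply: eq_bigr => i _.
    rewrite (bigD1 (p i)) //= big1 ?addn0 => [|j]; last first.
      by rewrite eq_sym => /negPf->; rewrite andbF.
    by rewrite eqxx /=; case: (i \in S); rewrite ?andbF.
  have cE' : c = (\sum_i \sum_j ([&& j != r, p j == i, j \notin S & i \notin S] : nat))%N.
    by rewrite cE exchange_big.
  rewrite {1}cE cE' -big_split; apply: eq_bigr => i _ /=.
  rewrite -big_split; apply: eq_bigr => j _ /=.
  have := rooted_edge_nat erp i j.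
  by case: (i \in S); case: (j \in S); rewrite /= ?andbF ?andbT.
have cS : #|~: S| = (c + #|tops|)%N.
  have -> : #|tops| = (\sum_(v | (v \notin S) && ((v == r) || (p v \in S))) 1)%N.
    by rewrite sum1dep_card.
  rewrite -sum1_card [X in (_ + X)%N]big_mkcondr /c -big_split /=.
  apply: eq_big => i; first by rewrite inE.
  by move=> _; case: (i == r); case: (p i \in S).
have := cardsC S; rewrite card_ord; lia.
Qed.

(** Under the hypothesis, an eigenvector vanishing at the top of each component vanishes all the way
    down. *)
Lemma mult1_le_tops :
    (forall x : 'rV_n, x *m del e S = x -> forall v w, v \notin S -> w \notin S ->
      e v w -> x 0 v = 0 -> x 0 w = 0) ->
  (m1 S <= #|tops|)%N.
Proof.
move=> prop; apply: (@rank_le_card_coords _ _ _ 1%:M) => x /eigenspaceP.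
rewrite scale1r => xS x0; apply/rowP => i; rewrite [RHS]mxE.
elim/(rooted_ind erp): i => [|v vr IH].
  have [rS|rS] := boolP (r \in S); first exact: eigen_del_supp xS rS.
  by rewrite -(x0 r) ?mulmx1 // inE rS eqxx.
have [vS|vS] := boolP (v \in S); first exact: eigen_del_supp xS vS.
have [pS|pS] := boolP (p v \in S); first by rewrite -(x0 v) ?mulmx1 // inE vS pS orbT.
apply: (prop x xS (p v)) => //.
by rewrite (rooted_sym erp) (rooted_parent erp).
Qed.

End Tops.

(** As the rank does not drop, [A *m P] and [P *m A *m P] have the same row space. The column of [z]
    is zero in the second, hence in the first, where it is the column of [A]. *)
Lemma del_isolated S z : \rank (del e S) = \rank A -> z \notin S ->
  (forall u, u \notin S -> ~~ e z u) -> forall u, ~~ e z u.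
Proof.
move=> rk zS zF u; pose P := indmx (~: S).
have sub : (P *m A *m P <= A *m P)%MS by rewrite -mulmxA submxMl.
have /submxP[Y YE] : (A *m P <= P *m A *m P)%MS.
  rewrite -(geq_leqif (mxrank_leqif_sup sub)) -delE rk.
  exact: mxrankM_maxl.
have /matrixP/(_ u z) := YE; rewrite mulmx_diagE !mxE !inE zS mulr1 => E.
rewrite (rootable_sym er); apply/negP => uz; move: E; rewrite uz big1.
  by move/eqP; rewrite oner_eq0.
move=> j _; rewrite -delE !mxE (rootable_sym er).
by case: (boolP (j \in S)) => jS; rewrite ?andbF ?mulr0 // (negPf (zF j jS)) mulr0.
Qed.

End Deletion.

(** * Deleted sets that raise the multiplicity of 1 *)

Definition parter_set n (e : rel 'I_n) (S : {set 'I_n}) :=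
  (mult1 e set0 + #|S| <= mult1 e S)%N /\
  forall x : 'rV_n, x *m del e S = x -> forall v w, v \notin S -> w \notin S ->
    e v w -> x 0 v = 0 -> x 0 w = 0.

(** A largest set with the first property has the second: otherwise [parter_deletion] would allow
    one more vertex. *)
Lemma exists_parter_set n (e : rel 'I_n) : rootable e -> exists S, parter_set e S.
Proof.
move=> er; pose good (S : {set 'I_n}) := (mult1 e set0 + #|S| <= mult1 e S)%N.
have good0 : good set0 by rewrite /good cards0 addn0.
have [S gS Smax] := @arg_maxnP _ set0 good (fun S : {set 'I_n} => #|S|) good0.
exists S; split => // x xS v w vS wS vw xv; apply/eqP/negPn/negP => xw.
have lt1 := parter_deletion er xS vS wS vw xv xw.
have : good (v |: S) by rewrite /good cardsU1 vS; move: gS; rewrite /good; lia.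
by move/Smax; rewrite cardsU1 vS /= ltnn.
Qed.

(** * Numerical constraints on integral trees of nullity 3 *)

Section IntegralNullityThree.

Variables (n : nat) (e : rel 'I_n).
Hypothesis er : rootable e.
Hypothesis A_int : forall a, eigenvalue (adjm e) a -> a \is a Num.int.
Hypothesis A_null : #|[set i | sdiag (adjm e) i == 0]| = 3%N.

Lemma spectrum_opp S i : exists j, sdiag (del e S) j = - sdiag (del e S) i.
Proof.
have := del_spectrum_opp er S (sdiag (del e S) i) => E.
have : (0 < #|[set j | sdiag (del e S) j == - sdiag (del e S) i]|)%N.
  by rewrite E; apply/card_gt0P; exists i; rewrite inE.
by case/card_gt0P => j; rewrite inE => /eqP; exists j.
Qed.

Section Parter.

Variable S : {set 'I_n}.
Hypothesis SP : parter_set e S.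

Let d := sdiag (del e S).
Let B := bigset (del e S).
Let m := mult1 e S.

Lemma parter_card : n = (3 + 2 * m + nbig (del e S))%N.
Proof. by have [_ _ _ + _] := del_equality er A_int SP.1; rewrite A_null. Qed.

Lemma parter_sum_big : \sum_(i in B) d i = 0.
Proof.
have := del_sum_big er A_int SP.1 (f := id) erefl.
rewrite subrr mul0rn add0r => <-.
by rewrite -(spectral_trace (del_herm S (rootable_sym er))) del_trace.
Qed.

Lemma parter_edges :
  ((\sum_i \sum_j [&& e i j, i \notin S & j \notin S])%N)%:R =
    (2 * m)%:R + \sum_(i in B) d i ^+ 2 :> algC.
Proof.
rewrite -(del_trace_sqr er) (spectral_trace_sqr (del_herm S (rootable_sym er))).
have -> := del_sum_big er A_int SP.1 (f := fun x => x ^+ 2) (expr0n _ 2).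
by rewrite sqrrN expr1n natrM mulr_natr.
Qed.

Lemma parter_rank : \rank (del e S) = \rank (adjm e).
Proof.
have [z0 _ _ _ _] := del_equality er A_int SP.1.
have S0 := spectral_shift_rank (del_herm S (rootable_sym er)) 0.
have A0 := spectral_shift_rank (adjm_herm (rootable_sym er)) 0.
rewrite raddf0 subr0 [X in (_ + X)%N]z0 in S0; rewrite raddf0 subr0 in A0.
exact: (addIn (etrans S0 (esym A0))).
Qed.

(** A vertex isolated after the deletion would be isolated in the whole tree, which has another
    vertex in [S]. *)
Lemma parter_nonisolated v : (0 < #|S|)%N -> v \notin S ->
  exists2 u, u \notin S & e v u.
Proof.
case/card_gt0P => w wS vS.
have [u /andP[uS vu]|none] := pickP [pred u | (u \notin S) && e v u]; first by exists u.
have iso : forall u, ~~ e v u.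
  apply: (del_isolated er parter_rank vS) => u uS.
  by have := none u; rewrite /= uS /= => ->.
have [p [h H]] := er w; have vw : v != w by apply: contraNneq vS => ->.
by have := rooted_parent H vw; rewrite (negPf (iso _)).
Qed.

Section Root.

Variables (r : 'I_n) (p : 'I_n -> 'I_n) (h : 'I_n -> nat).
Hypothesis erp : rooted e r p h.
Let c := #|tops r p S|.

Lemma parter_tops : (m <= c)%N.
Proof. exact: (mult1_le_tops erp SP.2). Qed.

Lemma parter_trace :
  \sum_(i in B) d i ^+ 2 + (2 * m)%:R + (2 * (#|S| + c))%:R = (2 * n)%:R.
Proof.
by rewrite [X in X + _]addrC -parter_edges -natrD (forest_edge_count erp).
Qed.

(** With [t] big eigenvalues and [q] deleted vertices, the trace gives
    [4 t + 2 m + 2 (q + c) <= 2 n], where [n = 3 + 2 m + t]. *)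
Lemma parter_bound : (nbig (del e S) + #|S| + c <= 3 + m)%N.
Proof.
have : (4 * nbig (del e S))%:R <= \sum_(i in B) d i ^+ 2.
  rewrite natrM mulr_natr -sumr_const; apply: ler_sum => i.
  by rewrite inE.
rewrite -(lerD2r (2 * m)%:R) -(lerD2r (2 * (#|S| + c))%:R) parter_trace.
rewrite -!natrD ler_nat; have := parter_card; lia.
Qed.

End Root.

(** The spectrum is symmetric, and a third big eigenvalue would be zero because the big ones sum to
    zero. *)
Lemma parter_big_pair : (0 < nbig (del e S) <= 3)%N ->
  exists i j, [/\ i != j, B = [set i; j] & d j = - d i].
Proof.
case/andP => /card_gt0P[i iB] B3; have [j] := spectrum_opp S i.
rewrite -/(d i) -/(d j) => dj.
have nz k : k \in B -> d k != 0.
  by rewrite inE; apply: contraTneq; rewrite -/(d k) => ->; rewrite expr0n (lern0 _ 4).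
have jB : j \in B by rewrite inE -/(d j) dj sqrrN; rewrite inE in iB.
have ij : i != j.
  apply: contraNneq (nz i iB) => E; move: dj; rewrite -E => /eqP.
  by rewrite -subr_eq0 opprK -mulr2n mulrn_eq0.
exists i, j; split => //; apply/setP => k; rewrite in_set2.
apply/idP/orP => [kB|[/eqP->|/eqP->] //].
apply/orP/negPn/negP; rewrite negb_or => /andP[ki kj].
have BE : B = [set i; j; k].
  apply/esym/eqP; rewrite eqEcard; apply/andP; split.
    by apply/subsetP => x; rewrite in_setU in_set2 in_set1 => /orP[/orP[]|] /eqP ->.
  by rewrite (leq_trans B3) // setUC cardsU1 !inE negb_or ki kj cards2 ij.
have /eqP := parter_sum_big; rewrite (bigD1 i) //= (bigD1 j) /=; last by rewrite jB eq_sym.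
rewrite (bigD1 k) /=; last by rewrite kB ki kj.
rewrite big_pred0; last first.
  move=> x; rewrite BE !inE.
  by case: (x == i); case: (x == j); case: (x == k).
by rewrite addr0 addrA dj subrr add0r (negPf (nz k kB)).
Qed.

End Parter.

End IntegralNullityThree.

(** * Cases by the numbers of deleted vertices and big eigenvalues *)

Section Cases.

Variables (n : nat) (e : rel 'I_n).
Hypothesis er : rootable e.
Hypothesis A_int : forall a, eigenvalue (adjm e) a -> a \is a Num.int.
Hypothesis A_null : #|[set i | sdiag (adjm e) i == 0]| = 3%N.

Lemma big_pair_sum S (i j : 'I_n) (d := sdiag (del e S)) : i != j ->
  bigset (del e S) = [set i; j] -> d j = - d i ->
  \sum_(k in bigset (del e S)) d k ^+ 2 = d i ^+ 2 *+ 2.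
Proof. by move=> ij -> dj; rewrite big_setU1 ?inE //= big_set1 dj sqrrN mulr2n. Qed.

(** There is one component, so 1 has multiplicity [m <= 1]. By the trace the big eigenvalues form an
    opposite pair with square [4 + m]; as 5 is not the square of an integer, [m = 0]. *)
Lemma parter_set0 : parter_set e set0 ->
  n = 5%N /\ adjm e *m adjm e *m adjm e = 4 *: adjm e.
Proof.
move=> SP; have nE := parter_card er A_int A_null SP.
have n0 : (0 < n)%N by rewrite nE.
have [p [h H]] := er (Ordinal n0).
have c1 : #|tops (Ordinal n0) p set0| = 1%N.
  by rewrite -(cards1 (Ordinal n0)); apply: eq_card => v; rewrite !inE orbF.
have m1 := parter_tops SP H; rewrite c1 in m1.
have bd := parter_bound er A_int A_null SP H; rewrite c1 cards0 in bd.
have tr := parter_trace er A_int SP H; rewrite c1 cards0 in tr.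
have B0 : (0 < nbig (del e set0))%N.
  rewrite lt0n; apply/negP => /eqP B0; move: tr nE.
  rewrite B0 (cards0_eq B0) big_set0 add0r -natrD => /eqP; rewrite eqr_nat.
  by move=> /eqP; lia.
have [|i [j [ij BE dj]]] := parter_big_pair er A_int SP.
  by rewrite B0 /=; lia.
have BB : nbig (del e set0) = 2%N by rewrite /nbig BE cards2 ij.
rewrite (big_pair_sum ij BE dj) in tr; rewrite BB in nE bd.
have di : sdiag (del e set0) i ^+ 2 = (4 + mult1 e set0)%:R.
  have : sdiag (del e set0) i ^+ 2 *+ 2 = (4 + mult1 e set0)%:R *+ 2.
    apply: (addIr (2 * mult1 e set0)%:R); apply: (addIr (2 * (0 + 1))%:R).
    rewrite tr -mulrnA -!natrD; congr _%:R.
    move: nE; lia.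
  by move/eqP; rewrite eqrMn2r => /eqP.
have m0 : mult1 e set0 = 0%N.
  have : eigenvalue (adjm e) (sdiag (adjm e) i).
    by apply/(eigenvalue_spectral (adjm_herm (rootable_sym er))); exists i.
  rewrite del0 in di; case/A_int/intrP => z zE; move: di; rewrite zE -rmorphXn /=.
  rewrite -[(_ + _)%:R]/((Posz (4 + mult1 e set0))%:~R) => /eqP; rewrite eqr_int.
  move: m1; case: (mult1 e set0) => [//|[|//]] _ /eqP zz; exfalso.
  have : z ^+ 2 = 5 by rewrite zz.
  clear; move=> z5.
  have : (z <= 2 /\ -2 <= z) \/ (3 <= z \/ z <= -3) by lia.
  by case=> [[]|[]]; nia.
split; first by rewrite nE m0.
apply: (spectral_cubic (adjm_herm (rootable_sym er))) => k.
have [_ _ _ _ cl] := del_equality er A_int SP.1.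
have e1 := eigenspace_rank (del_herm set0 (rootable_sym er)) 1.
have em1 := del_spectrum_opp er set0 1.
rewrite -/(mult1 e set0) m0 in e1; rewrite -[X in _ = X]e1 in em1.
rewrite -[spectral_diag (adjm e) 0 k]/(sdiag (adjm e) k) -del0.
case/or4P: (cl k) => [/eqP->|k1|k1|kB].
- by rewrite expr0n mulr0.
- by have := cards0_eq (esym e1) => /setP/(_ k); rewrite !inE -/(sdiag _ k) k1.
- by have := cards0_eq em1 => /setP/(_ k); rewrite !inE k1.
have : k \in bigset (del e set0) by rewrite inE.
rewrite BE exprS mulrC => /set2P[]->; rewrite ?dj ?sqrrN di m0 addn0 //.
Qed.

(** The degrees in the remaining forest are positive and sum to [2 m], while [n = 3 + 2 m]. So at
    most [2 m] vertices remain, and if exactly three are deleted every degree is one. *)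
Lemma parter_no_big S : parter_set e S -> (0 < #|S|)%N ->
  nbig (del e S) = 0%N ->
  (3 <= #|S|)%N /\ (#|S| = 3%N -> forall v u u', v \notin S -> u \notin S ->
    u' \notin S -> e v u -> e v u' -> u = u').
Proof.
move=> SP S0 B0; have := parter_edges er A_int SP; rewrite (cards0_eq B0) big_set0 addr0.
move=> /eqP; rewrite eqr_nat => /eqP E; have := parter_card er A_int A_null SP.
rewrite B0 addn0 => nE.
pose deg v := (\sum_j [&& e v j, v \notin S & j \notin S])%N.
have deg_gt0 v : v \notin S -> (0 < deg v)%N.
  move=> vS; have [u uS vu] := parter_nonisolated er A_int SP S0 vS.
  by rewrite /deg (bigD1 u) //= vS uS vu.
have E' : (\sum_(v in ~: S) deg v = 2 * mult1 e S)%N.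
  rewrite -E [RHS](bigID (fun v => v \in ~: S)) /= [X in (_ + X)%N]big1 ?addn0 // => v.
  by rewrite inE negbK => vS; apply: big1 => j _; rewrite vS andbF.
have cS : #|~: S| = (\sum_(v in ~: S) 1)%N by rewrite sum1_card.
have nS := cardsC S; rewrite card_ord in nS.
have le : (#|~: S| <= 2 * mult1 e S)%N.
  by rewrite cS -E' leq_sum // => v; rewrite inE => /deg_gt0.
split; first by lia.
move=> S3 v u u' vS uS u'S vu vu'; apply/eqP/negPn/negP => uu'.
suff : (#|~: S| < 2 * mult1 e S)%N by lia.
rewrite -E' (bigD1 v) ?inE //= cS (bigD1 v) ?inE //= -addSn leq_add //.
  by rewrite /deg (bigD1 u) //= (bigD1 u') 1?eq_sym //= vu vu' vS uS u'S.
by apply: leq_sum => w /andP[]; rewrite inE => /deg_gt0.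
Qed.

Lemma no_parter_set1 S : parter_set e S -> #|S| = 1%N ->
  nbig (del e S) = 2%N -> False.
Proof.
move=> SP S1 B2; have /eqP/cards1P[c Sc] := S1.
have nE := parter_card er A_int A_null SP; rewrite B2 in nE.
have [p [h H]] := er c; have [h0 hp ep] := H.
have es := rootable_sym er.
pose C1 := [set v | (v != c) && (p v == c)].
have tE : tops c p S = C1.
  apply/setP => v; rewrite !inE Sc !inE; case: eqVneq => //=.
have m_le := parter_tops SP H; have bd := parter_bound er A_int A_null SP H.
rewrite tE S1 B2 in bd m_le.
set m := mult1 e S in bd m_le nE.
have C1m : #|C1| = m by lia.
pose ch u := #|[set v | (v != c) && (p v == u)]|.
pose C2 := [set v | h v == 2%N].
pose C3 := [set v | h v == 3%N].
have hC1 u : (u \in C1) = (h u == 1%N).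
  rewrite inE; have [->|uc] := eqVneq u c; first by rewrite h0.
  rewrite (hp u uc) eqSS; have [->|puc] := eqVneq (p u) c; first by rewrite h0.
  by have := rooted_height_gt0 H puc; case: (h (p u)).
have ch_gt0 u : u \in C1 -> (0 < ch u)%N.
  rewrite inE => /andP[uc /eqP pu].
  have uS : u \notin S by rewrite Sc inE.
  have [w wS uw] : exists2 w, w \notin S & e u w.
    by apply: (parter_nonisolated er A_int SP) => //; rewrite S1.
  rewrite Sc inE in wS; move: uw; rewrite ep uc pu (eq_sym c) (negPf wS) /= => pw.
  by apply/card_gt0P; exists w; rewrite inE wS.
have HE : #|C2| = (\sum_(u in C1) ch u)%N.
  rewrite -sum1_card (partition_big p (mem C1)) /=; last first.
    move=> v; rewrite inE => /eqP hv; have [vc|vc] := eqVneq v c; first by rewrite vc h0 in hv.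
    by rewrite hC1; move: (hp v vc); rewrite hv => -[<-].
  apply: eq_bigr => u uC1; rewrite sum1dep_card; apply: eq_card => v; rewrite !inE.
  have [pv|_] := eqVneq (p v) u; rewrite ?andbF ?andbT //.
  have [->|vc] := eqVneq v c; first by rewrite h0.
  by rewrite (hp v vc) pv eqSS -hC1.
have C2m : (m <= #|C2|)%N.
  by rewrite HE -C1m -sum1_card leq_sum.
(* With nothing beyond one child per neighbour of [c] there would be only [2 m + 1] vertices instead
   of [2 m + 5]. *)
have big : (0 < #|C3| + (#|C2| - m))%N.
  rewrite lt0n addn_eq0 subn_eq0; apply/negP => /andP[/eqP C30 C2le].
  have h2 v : (h v <= 2)%N.
    elim/(rooted_ind H): v => [|v vc IH]; first by rewrite h0.
    have := cards0_eq C30 => /setP/(_ v); rewrite !inE (hp v vc) eqSS => /negbT.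
    by rewrite ltnS; case: ltngtP IH.
  have : (#|[set: 'I_n]| <= #|[set c]| + #|C1| + #|C2|)%N.
    apply: leq_trans (_ : #|[set c] :|: C1 :|: C2| <= _)%N.
      apply: subset_leq_card; apply/subsetP => v _; rewrite !in_setU hC1 !inE.
      have [//|vc] := eqVneq v c; have := h2 v; have := rooted_height_gt0 H vc.
      by case: (h v) => [|[|[|]]].
    by apply: leq_trans (leq_card_setU _ _) _; rewrite leq_add2r leq_card_setU.
  by rewrite cardsT card_ord cards1 C1m; lia.
(* On the star with [m] rays of length two, this is the Perron eigenvector restricted to even
   heights; the square of its eigenvalue is [m + 1]. *)
pose zn v := if v == c then m else (h v == 2%N) : nat.
pose y u := (\sum_v zn v * e v u)%N.
have y1 u : u \in C1 -> (m + ch u <= y u)%N.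
  rewrite inE => /andP[uc /eqP pu]; rewrite /y (bigD1 c) //= leq_add //.
    by rewrite /zn eqxx es (rooted_root_nb H) uc pu eqxx muln1.
  rewrite /ch -sum1_card big_mkcond [leqRHS]big_mkcond leq_sum // => v _.
  rewrite inE /zn; have [//|vc] := eqVneq v c; case: eqVneq => //= pv.
  by rewrite (hp v vc) pv (hp u uc) pu h0 ep vc pv !eqxx.
have y3 u : u \in C3 -> (1 <= y u)%N.
  rewrite inE => /eqP hu; have uc : u != c by apply: contra_eqN hu => /eqP->; rewrite h0.
  have hpu : h (p u) = 2%N by move: (hp u uc); rewrite hu => -[].
  have puc : p u != c by apply: contra_eqN hpu => /eqP->; rewrite h0.
  by rewrite /y (bigD1 (p u)) //= /zn (negPf puc) hpu /= es (rooted_parent H uc).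
have zsq : (\sum_v zn v ^ 2 = m ^ 2 + #|C2|)%N.
  rewrite (bigD1 c) //= {1}/zn eqxx; congr addn.
  rewrite -sum1_card big_mkcond [RHS]big_mkcond; apply: eq_bigr => v _.
  rewrite inE /zn; have [->|_] := eqVneq v c; first by rewrite h0.
  by case: (h v == 2%N).
(* A neighbour of [c] with [a] children contributes at least [(m + a) ^ 2], and [a <= a ^ 2]. *)
have ysq : (m * m ^ 2 + (2 * m + 1) * #|C2| + #|C3| <= \sum_u y u ^ 2)%N.
  rewrite (bigID (fun u => u \in C1)) /=; apply: leq_add.
    rewrite HE big_distrr -{1}C1m -sum1_card big_distrl /= -big_split /=.
    apply: leq_sum => u uC1; have := y1 u uC1; have := ch_gt0 u uC1.
    clear; move: (ch u) (y u) => a b; nia.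
  rewrite -sum1_card big_mkcond [leqRHS]big_mkcond leq_sum // => u _.
  rewrite hC1; have [uC3|//] := boolP (u \in C3).
  by have := y3 u uC3; rewrite inE in uC3; rewrite (eqP uC3) /= expn_gt0 => ->.
(* The difference is at least [m * (#|C2| - m) + #|C3|], positive by [big] since [C2] is empty when
   [m = 0]. *)
have lt_sq : ((m + 1) * (\sum_v zn v ^ 2) < \sum_u y u ^ 2)%N.
  apply: leq_trans ysq; rewrite zsq.
  have m0 : m = 0%N -> #|C2| = 0%N.
    by rewrite HE => m0; rewrite big1 // => u; rewrite (cards0_eq (etrans C1m m0)) inE.
  move: C2m big m0; move: #|C2| #|C3| => x w; clear => mx xw m0.
  have : (m * m <= m * x)%N by rewrite leq_mul2l mx orbT.
  have [mz|m_gt0] := posnP m; first by move: xw; rewrite (m0 mz) mz; nia.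
  rewrite -mulnn; have [xm|mx'] := eqVneq x m; first by rewrite xm in xw *; nia.
  have : (m * m.+1 <= m * x)%N by rewrite leq_mul2l; lia.
  by nia.
pose z : 'rV[algC]_n := \row_v (zn v)%:R.
have zE : sqn z = (\sum_v zn v ^ 2)%:R.
  by rewrite natr_sum; apply: eq_bigr => v _; rewrite mxE normr_nat natrX.
have zAE : sqn (z *m adjm e) = (\sum_u y u ^ 2)%:R.
  rewrite natr_sum; apply: eq_bigr => u _.
  have -> : (z *m adjm e) 0 u = (y u)%:R.
    by rewrite mxE natr_sum; apply: eq_bigr => v _; rewrite !mxE natrM.
  by rewrite normr_nat natrX.
have Ah := adjm_herm es.
have [i di] : exists i, (m + 1)%:R < sdiag (adjm e) i ^+ 2.
  apply/existsP; apply: contraT => /existsPn le; exfalso; move: lt_sq.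
  rewrite ltnNge => /negP; apply; rewrite -(ler_nat algC) natrM -zE -zAE.
  apply: (spectral_sqnM_le Ah) => k.
  by rewrite real_leNgt ?realn ?rpredX ?(spectral_real Ah) //; exact: le.
have g0 : (mult1 e set0 + #|(set0 : {set 'I_n})| <= mult1 e set0)%N.
  by rewrite cards0 addn0.
have [_ mS bS _ _] := del_equality er A_int SP.1.
rewrite S1 -/m in mS; rewrite S1 B2 in bS.
have tops0 : #|tops c p set0| = 1%N.
  by rewrite -(cards1 c); apply: eq_card => v; rewrite !inE orbF.
have := forest_edge_count H set0; rewrite cards0 tops0.
have := del_trace_sqr er set0; rewrite (spectral_trace_sqr (del_herm set0 es)).
rewrite (del_sum_big er A_int g0 (f := fun x => x ^+ 2) (expr0n _ 2)) => trE edges.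
(* Twice the number of edges is [4 m + 8], of which the eigenvalues 1 and -1, each of multiplicity
   [m - 1], account for [2 m - 2]. *)
have sumB : \sum_(k in bigset (adjm e)) sdiag (adjm e) k ^+ 2 = (2 * m + 10)%:R.
  apply: (addrI ((1 ^+ 2 + (- 1) ^+ 2) *+ mult1 e set0)); rewrite -del0 trE.
  rewrite sqrrN expr1n -(natrD _ 1 1) -mulrnA -natrD; congr _%:R.
  move: edges; lia.
have inB k : (m + 1)%:R < sdiag (adjm e) k ^+ 2 -> k \in bigset (adjm e).
  move=> dk; have := integral_spectrum_classes er A_int k; rewrite inE.
  case/or4P => // /eqP dk0; move: dk; rewrite dk0 ?sqrrN ?expr1n ?expr0n;
  rewrite ?(ltr_nat _ _ 1) ?(ltr_nat _ _ 0) addn1 //.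
have [j dj] := spectrum_opp er set0 i; rewrite del0 in dj.
have dj' : (m + 1)%:R < sdiag (adjm e) j ^+ 2 by rewrite dj sqrrN.
have ij : i != j.
  apply: contraTneq di => E; move: dj; rewrite -E => /eqP.
  rewrite -subr_eq0 opprK -mulr2n mulrn_eq0 /= => /eqP->.
  by rewrite expr0n (ltr_nat _ _ 0).
have := sumB; rewrite (bigD1 i) ?inB //= (bigD1 j) /=; last by rewrite inB // eq_sym.
set T := \sum_(_ | _) _ => sum4.
(* Four eigenvalues of the tree are big: two remain besides [i] and [j]. *)
have T8 : 8 <= T.
  have -> : 8 = \sum_(k in bigset (adjm e) :\ i :\ j) (4 : algC).
    rewrite sumr_const -mulrnA; congr _%:R.
    have := bS; rewrite /nbig (cardsD1 i) inB // (cardsD1 j) in_setD1 eq_sym ij inB //.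
    by move=> [E]; rewrite !add0n in E; rewrite -E.
  rewrite [T](eq_bigl (fun k => k \in bigset (adjm e) :\ i :\ j)).
    by apply: ler_sum => k /setD1P[_ /setD1P[_]]; rewrite inE.
  by move=> k; rewrite !in_setD1 andbC [X in _ && X]andbC.
have : (m + 1)%:R + ((m + 1)%:R + 8) < (2 * m + 10)%:R :> algC.
  by rewrite -sum4 ltrD // ltr_leD.
by rewrite -!natrD ltr_nat; lia.
Qed.

End Cases.

(** * Three deleted vertices *)

Definition gap5 (s t : int) := [|| s == t, s + 5 <= t | t + 5 <= s].

(** The squares concerned are 4, 9, 16 and so on, with smallest gap 5. *)
Lemma square_gap5 (x y : int) : 4 <= x ^+ 2 -> 4 <= y ^+ 2 ->
  gap5 (x ^+ 2 - 1) (y ^+ 2 - 1).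
Proof.
wlog x_ge0 : x y / 0 <= x => [H x4 y4|].
  by case: (lerP 0 x) => [/H|x_lt0]; [apply | rewrite -sqrrN; apply: H; rewrite ?sqrrN //; lia].
wlog y_ge0 : y / 0 <= y => [H x4 y4|].
  case: (lerP 0 y) => [/H|y_lt0]; [by apply | rewrite -(sqrrN y); apply: H => //].
    by lia.
  by rewrite sqrrN.
move=> x4 y4; have x2 : 2 <= x by nia.
have y2 : 2 <= y by nia.
rewrite /gap5; have [->|xy] := eqVneq x y; first by rewrite eqxx.
apply/or3P; have [lt_xy|lt_yx] : x + 1 <= y \/ y + 1 <= x by lia.
  by apply: Or32; nia.
by apply: Or33; nia.
Qed.

(* With a = t1 - d1, b = d3 - t3, u = t1 - t2 and v = t2 - t3, comparing the
   sums of squares gives a u + b v - (a^2 - a b + b^2) = E, and d sorted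
   gives a u + b v >= 2 (a^2 - a b + b^2); hence a u + b v <= 2 E <= 6. *)
Lemma no_spectrum_sorted (d1 d2 d3 t1 t2 t3 E : int) :
  d1 >= d2 -> d2 >= d3 -> t1 >= t2 -> t2 >= t3 -> gap5 t1 t2 -> gap5 t2 t3 ->
  d1 <= t1 -> t3 <= d3 -> 1 <= E -> E <= 3 -> t1 + t2 + t3 = d1 + d2 + d3 ->
  t1 * t1 + t2 * t2 + t3 * t3 = d1 * d1 + d2 * d2 + d3 * d3 + 2 * E -> False.
Proof.
move=> d12 d23 t12 t23 g12 g23 d1t t3d E1 E3 s1 s2.
pose a := t1 - d1; pose b := d3 - t3; pose u := t1 - t2; pose v := t2 - t3.
have a0 : 0 <= a by rewrite /a; lia.
have b0 : 0 <= b by rewrite /b; lia.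
have u_cond : u = 0 \/ 5 <= u by move: g12; rewrite /gap5 /u; lia.
have v_cond : v = 0 \/ 5 <= v by move: g23; rewrite /gap5 /v; lia.
have ub : 2 * a - b <= u by rewrite /a /b /u; lia.
have vb : 2 * b - a <= v by rewrite /a /b /v; lia.
have key : a * u + b * v - (a * a - a * b + b * b) = E.
  have t2E : t2 = d1 + d2 + d3 - t1 - t3 by lia.
  have : 2 * (a * u + b * v - (a * a - a * b + b * b)) = 2 * E.
    rewrite (_ : 2 * E = t1 * t1 + t2 * t2 + t3 * t3 - (d1 * d1 + d2 * d2 + d3 * d3)).
      by rewrite /a /b /u /v t2E; ring.
    by rewrite s2; ring.
  by lia.
clearbody a b u v; clear -a0 b0 u_cond v_cond ub vb key E1 E3.
have le6 : a * u + b * v <= 2 * E by nia.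
(* If [2 <= a], then [5 <= u] makes [a * u] exceed 6, while [u = 0] forces [4 <= b] and [5 <= v]. *)
have a1 : a <= 1 by case: u_cond => [u0|u5]; case: v_cond => [v0|v5]; nia.
have b1 : b <= 1 by case: u_cond => [u0|u5]; case: v_cond => [v0|v5]; nia.
(* What is left gives [E = 0], or makes [u], [v] or [u + v] equal to [E + 1], between 2 and 4. *)
have [a_eq|a_eq] : a = 0 \/ a = 1 by lia.
  have [b_eq|b_eq] : b = 0 \/ b = 1 by lia.
    by subst; lia.
  by subst; lia.
have [b_eq|b_eq] : b = 0 \/ b = 1 by lia.
  by subst; lia.
by subst; lia.
Qed.

(** Meant for a symmetric 3 x 3 matrix with diagonal [ds], eigenvalues [ts] and [E] off-diagonal
    pairs equal to 1, the others being 0. *)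
Lemma no_spectrum (ds ts : seq int) (E : int) :
  size ds = 3%N -> size ts = 3%N -> {in ts &, forall s t, gap5 s t} ->
  {in ds, forall d, (exists2 t, t \in ts & d <= t) /\ (exists2 t, t \in ts & t <= d)} ->
  1 <= E -> E <= 3 -> \sum_(t <- ts) t = \sum_(d <- ds) d ->
  \sum_(t <- ts) t * t = \sum_(d <- ds) d * d + 2 * E -> False.
Proof.
wlog ts_sorted : ts / sorted >=%O ts => [H ds3 ts3 gap bnd E1 E3 s1 s2|].
  have sP : perm_eq (sort >=%O ts) ts by rewrite perm_sort.
  apply: (H (sort >=%O ts)) => //; rewrite ?size_sort ?(perm_big _ sP) //.
  - by apply: sort_sorted => x y; apply: le_total.
  - by move=> s t; rewrite !mem_sort; apply: gap.
  - by move=> d /bnd[[t tts le1] [t' t'ts le2]]; split; [exists t | exists t'];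
      rewrite ?mem_sort.
wlog ds_sorted : ds / sorted >=%O ds => [H ds3 ts3 gap bnd E1 E3 s1 s2|].
  have sP : perm_eq (sort >=%O ds) ds by rewrite perm_sort.
  apply: (H (sort >=%O ds)) => //; rewrite ?size_sort ?(perm_big _ sP) //.
  - by apply: sort_sorted => x y; apply: le_total.
  - by move=> d; rewrite mem_sort; apply: bnd.
case: ds ds_sorted => [|d1 [|d2 [|d3 []]]] //= /and3P[d12 d23 _] _.
case: ts ts_sorted => [|t1 [|t2 [|t3 []]]] //= /and3P[t12 t23 _] _ gap bnd E1 E3.
rewrite !big_cons !big_nil !addr0 !addrA => s1 s2.
apply: (no_spectrum_sorted d12 d23 t12 t23 _ _ _ _ E1 E3 s1 s2).
- by apply: gap; rewrite !inE eqxx ?orbT.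
- by apply: gap; rewrite !inE eqxx ?orbT.
- have [[t + le] _] := bnd d1 (mem_head _ _); rewrite !inE => tts.
  by apply: le_trans le _; case/or3P: tts => /eqP ->; lia.
- have [|_ [t + le]] := bnd d3; first by rewrite !inE eqxx !orbT.
  by rewrite !inE => tts; apply: le_trans le; case/or3P: tts => /eqP ->; lia.
Qed.

(** * The perfect matching left by three deleted vertices *)

Section ThreeHubs.

Variables (n : nat) (e : rel 'I_n).
Hypothesis er : rootable e.
Hypothesis A_int : forall a, eigenvalue (adjm e) a -> a \is a Num.int.
Hypothesis A_null : #|[set i | sdiag (adjm e) i == 0]| = 3%N.
Variable S : {set 'I_n}.
Hypothesis SP : parter_set e S.
Hypothesis S3 : #|S| = 3%N.
Hypothesis S_nbig : nbig (del e S) = 0%N.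

Let A := adjm e.
Let N := del e S.
Let P : 'M[algC]_n := indmx (~: S).

Let S_gt0 : (0 < #|S|)%N. Proof. by rewrite S3. Qed.

Let mate_uniq v u u' : v \notin S -> u \notin S -> u' \notin S ->
  e v u -> e v u' -> u = u'.
Proof. exact: (parter_no_big er A_int A_null SP S_gt0 S_nbig).2 S3 _ _ _. Qed.

Let mate_ex v : v \notin S -> exists2 u, u \notin S & e v u.
Proof. exact: (parter_nonisolated er A_int SP S_gt0). Qed.

Let es := rootable_sym er.

Lemma hubs_mate_sqr : N *m N = P.
Proof.
apply/matrixP => i k; rewrite !mxE inE.
have [<-|ik] := eqVneq i k; last first.
  apply: big1 => j _; rewrite !mxE -natrM mulnb.
  case: (boolP (e i j)) => //= ij; case: (boolP (e j k)) => [jk|]; last by rewrite andbF.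
  case: (boolP (i \in S)) => //= iS; case: (boolP (j \in S)) => //= jS.
  case: (boolP (k \in S)) => //= kS.
  by rewrite (mate_uniq jS iS kS) ?eqxx // es in ik.
have [iS|iS] := boolP (i \in S); rewrite /= ?mulr0n ?mulr1n.
  by apply: big1 => j _; rewrite !mxE iS !andbF mul0r.
have [u uS iu] := mate_ex iS.
rewrite (bigD1 u) //= !mxE (es u) iu iS uS mulr1 big1 ?addr0 // => j ju.
rewrite !mxE iS andbT; case: (boolP (e i j && _)) => [/andP[ij jS]|]; rewrite ?mul0r //.
by rewrite (mate_uniq iS uS jS iu ij) eqxx in ju.
Qed.

(** [A] has the rank of [N], which is its own inverse outside [S], so the Schur complement of that
    block vanishes. *)
Lemma hubs_adjm : A = A *m N *m A.
Proof.
have rk := parter_rank er A_int SP.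
have /submxP[Z ZE] : (A <= P *m A)%MS.
  rewrite -(geq_leqif (mxrank_leqif_sup (submxMl P A))) -rk delE.
  exact: mxrankM_maxl.
have AP : A *m P = Z *m N by rewrite {1}ZE /N delE !mulmxA.
have PN : P *m N = N by rewrite /N delE !mulmxA indmxM setIid.
have -> : A *m N = Z *m P by rewrite -{1}PN mulmxA AP -mulmxA hubs_mate_sqr.
by rewrite -mulmxA -ZE.
Qed.

(** In [A = A *m N *m A] all entries are nonnegative, so a single walk through an edge of [N] makes
    the entry of [A] nonzero. *)
Lemma hubs_path4 i u w j : u \notin S -> w \notin S -> e i u -> e u w -> e w j ->
  e i j.
Proof.
move=> uS wS iu uw wj; have /matrixP/(_ i j) := hubs_adjm; rewrite mxE.
case: (e i j) => // /esym/eqP; rewrite mxE psumr_eq0; last first.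
  move=> k _; rewrite mxE mulr_ge0 // ?mxE ?ler0n //.
  by apply: sumr_ge0 => l _; rewrite !mxE mulr_ge0 ?ler0n.
move/allP/(_ w (mem_index_enum _)); rewrite !mxE wj mulr1 psumr_eq0; last first.
  by move=> l _; rewrite !mxE mulr_ge0 ?ler0n.
move/allP/(_ u (mem_index_enum _)); rewrite !mxE iu uw uS wS mulr1.
by rewrite oner_eq0.
Qed.

(** By [hubs_adjm] an edge from [i] to [j] comes with a path through two vertices outside [S],
    closing a cycle of length four. *)
Lemma hubs_nonadj i j : i \in S -> j \in S -> e i j = false.
Proof.
move=> iS jS; apply/negP => ij; have /matrixP/(_ i j) := hubs_adjm; rewrite mxE ij.
move=> E; have : exists u w, [/\ u \notin S, w \notin S, e i u, e u w & e w j].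
  have [[u w] /= /and5P[]|none] := pickP [pred uw : 'I_n * 'I_n |
      [&& uw.1 \notin S, uw.2 \notin S, e i uw.1, e uw.1 uw.2 & e uw.2 j]].
    by exists u, w.
  move: E => /eqP; rewrite mxE big1 ?oner_eq0 // => w _; rewrite mxE.
  case: (boolP (e w j)) => wj; last by rewrite mxE (negPf wj) mulr0.
  rewrite big1 ?mul0r // => u _; rewrite !mxE -natrM mulnb.
  have := none (u, w); rewrite /= wj andbT.
  by case: (e i u); case: (e u w); case: (u \in S); case: (w \in S).
case=> u [w [uS wS iu uw wj]]; have iw : i != w by apply: contraTneq iS => ->.
have uj := rootable_common_nb er iw iu; rewrite es uw in uj.
by move: uS; rewrite (uj j isT ij wj) jS.
Qed.

Lemma hubs_path4_free i u w j : i \in S -> j \in S -> u \notin S -> w \notin S ->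
  e i u -> e u w -> e w j -> False.
Proof.
by move=> iS jS uS wS iu uw wj; have := hubs_path4 uS wS iu uw wj; rewrite hubs_nonadj.
Qed.

(** Climb from a vertex of [S] to a root in [S]. The parent is outside [S]; if the grandparent is
    too, the next vertex either lies in [S] and completes a forbidden path, or is a second partner
    of the grandparent in the matching. *)
Lemma hubs_common : exists s t u, [/\ s \in S, t \in S, s != t, e s u & e t u].
Proof.
have [r rS] : exists r, r \in S by apply/card_gt0P.
have [s] : exists s, s \in S :\ r.
  by apply/card_gt0P; have := S3; rewrite (cardsD1 r) rS; case: #|S :\ r|.
case/setD1P => sr sS; have [p [h H]] := er r; have [h0 hp ep] := H.
have su := rooted_parent H sr; set u := p s in su.
have uS : u \notin S by apply/negP => uS; rewrite hubs_nonadj in su.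
have ur : u != r by apply: contraNneq uS => ->.
have uw := rooted_parent H ur; set w := p u in uw.
have hs : h s = (h w).+2 by rewrite (hp s sr) (hp u ur).
have [wS|wS] := boolP (w \in S).
  exists s, w, u; split => //; last by rewrite es.
  by apply/eqP => sw; move: hs; rewrite sw; lia.
have wr : w != r by apply: contraNneq wS => ->.
have wx := rooted_parent H wr; set x := p w in wx.
have [xS|xS] := boolP (x \in S).
  by case: (hubs_path4_free sS xS uS wS su uw wx).
have wu : e w u by rewrite es.
have ux := mate_uniq wS uS xS wu wx.
by have := hp u ur; rewrite -/w (hp w wr) -/x -ux; lia.
Qed.

End ThreeHubs.

(** * The matrix of common neighbours of the deleted vertices *)

Section HubMatrix.

Variables (n : nat) (e : rel 'I_n).
Hypothesis er : rootable e.
Hypothesis A_int : forall a, eigenvalue (adjm e) a -> a \is a Num.int.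
Hypothesis A_null : #|[set i | sdiag (adjm e) i == 0]| = 3%N.
Variable S : {set 'I_n}.
Hypothesis SP : parter_set e S.
Hypothesis S3 : #|S| = 3%N.
Hypothesis S_nbig : nbig (del e S) = 0%N.

Let A := adjm e.
Let N := del e S.
Let P : 'M[algC]_n := indmx (~: S).
Let es := rootable_sym er.

Definition hub (k : 'I_3) : 'I_n := enum_val (cast_ord (esym S3) k).

Lemma hub_inj : injective hub.
Proof. by move=> k l /enum_val_inj/cast_ord_inj. Qed.

Lemma hubP k : hub k \in S. Proof. exact: enum_valP. Qed.

Lemma hub_surj s : s \in S -> exists k, hub k = s.
Proof.
move=> sS; exists (cast_ord S3 (enum_rank_in sS s)).
by rewrite /hub cast_ordK enum_rankK_in.
Qed.

Definition hubmx : 'M[algC]_(3, n) := \matrix_(k, v) (v == hub k)%:R.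
Local Notation W := hubmx.

Lemma hubmxE m (M : 'M[algC]_(n, m)) k v : (W *m M) k v = M (hub k) v.
Proof.
rewrite mxE (bigD1 (hub k)) //= mxE eqxx mul1r big1 ?addr0 // => j /negPf jk.
by rewrite mxE jk mul0r.
Qed.

Lemma hubmx_trE m (M : 'M[algC]_(m, n)) v k : (M *m W^T) v k = M v (hub k).
Proof.
rewrite mxE (bigD1 (hub k)) //= !mxE eqxx mulr1 big1 ?addr0 // => j /negPf jk.
by rewrite !mxE jk mulr0.
Qed.

Lemma hubmx_mul_tr : W *m W^T = 1%:M.
Proof.
by apply/matrixP => k l; rewrite hubmx_trE !mxE (inj_eq hub_inj) eq_sym.
Qed.

Lemma hubmx_tr_mul : W^T *m W = indmx S.
Proof.
apply/matrixP => i j; rewrite !mxE.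
have [iS|iS] := boolP (i \in S); last first.
  rewrite mul0rn; apply: big1 => k _; rewrite !mxE.
  case: eqVneq => [ik|]; rewrite ?mul0r //.
  by rewrite ik hubP in iS.
have [k <-] := hub_surj iS; rewrite (bigD1 k) //= !mxE eqxx mul1r big1 ?addr0.
  by rewrite eq_sym.
by move=> l lk; rewrite !mxE (inj_eq hub_inj) eq_sym (negPf lk) mul0r.
Qed.

Lemma mulmx_split_hubs m (M : 'M[algC]_(m, n)) : M = M *m P + M *m W^T *m W.
Proof. by rewrite -mulmxA hubmx_tr_mul /P indmxC mulmxBr mulmx1 subrK. Qed.

Lemma hubmx_adj : W *m A *m W^T = 0.
Proof.
apply/matrixP => k l; rewrite hubmx_trE hubmxE !mxE.
by rewrite (hubs_nonadj er A_int A_null SP S3 S_nbig) ?hubP.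
Qed.

Lemma del_hubmx : N *m W^T = 0.
Proof. by apply/matrixP => k l; rewrite hubmx_trE !mxE hubP !andbF. Qed.

Let PP : P *m P = P. Proof. by rewrite indmxM setIid. Qed.
Let NP : N *m P = N. Proof. by rewrite /N delE -mulmxA PP. Qed.
Let PN : P *m N = N. Proof. by rewrite /N delE !mulmxA PP. Qed.

(** Both the Gram matrix of the rows of [A] at [S] and the table of numbers of common neighbours. *)
Definition hubQ : 'M[algC]_3 := W *m A *m A *m W^T.

(** The span of [x *m W], [b] and [b *m N] is stable under [A], which sends them to [b],
    [b *m N + theta *: (x *m W)] and [b]. The eigenvector is found there. *)
Lemma hubQ_eigen (x : 'rV_3) theta : x != 0 -> x *m hubQ = theta *: x ->
  0 < theta -> eigenvalue A (sqrtC (theta + 1)).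
Proof.
move=> x0 xQ th0; pose b := x *m W *m A; set la := sqrtC _.
have bW : b *m W^T = 0 by rewrite /b -!mulmxA (mulmxA W) hubmx_adj mulmx0.
have bP : b *m P = b by rewrite [RHS](mulmx_split_hubs b) bW mul0mx addr0.
have bA : b *m A = b *m N + theta *: (x *m W).
  rewrite (mulmx_split_hubs (b *m A)); congr (_ + _).
    by rewrite /N delE !mulmxA bP.
  by rewrite scalemxAl -xQ /b /hubQ !mulmxA.
have NAP : N *m A *m P = P.
  rewrite -[RHS](hubs_mate_sqr er A_int A_null SP S3 S_nbig) -/N -{1}NP -!mulmxA.
  by congr (_ *m _); rewrite /N delE !mulmxA.
have bNA : b *m N *m A = b.
  rewrite (mulmx_split_hubs (_ *m A)) (_ : _ *m W^T = 0) ?mul0mx ?addr0.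
    by rewrite -(mulmxA b N A) -(mulmxA b) NAP bP.
  have -> : b *m N *m A = x *m W *m (A *m N *m A) by rewrite /b !mulmxA.
  by rewrite -(hubs_adjm er A_int A_null SP S3 S_nbig) -/A -/b bW.
apply/eigenvalueP; exists (x *m W + theta^-1 *: (la *: b + b *m N)).
  rewrite mulmxDl -scalemxAl mulmxDl -scalemxAl bA bNA.
  have thN : theta != 0 by rewrite gt_eqF.
  rewrite -/b; have la2 : la * la = theta + 1 by rewrite -expr2 sqrtCK.
  move: (x *m W) (b *m N) => p s; clearbody b la.
  apply/rowP => i; rewrite !mxE; move: (p 0 i) (b 0 i) (s 0 i) => {}p q {}s.
  rewrite (_ : la * (p + theta^-1 * (la * q + s)) =
    la * p + theta^-1 * ((la * la) * q + la * s)); last by ring.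
  by rewrite la2; field.
apply: contraNneq x0 => /(congr1 (mulmx^~ W^T)); rewrite mul0mx mulmxDl -mulmxA.
rewrite hubmx_mul_tr mulmx1 -scalemxAl mulmxDl -scalemxAl bW -mulmxA del_hubmx.
by rewrite mulmx0 scaler0 addr0 scaler0 addr0 => ->.
Qed.

Lemma hubmx_tr_conj : (W^t*) = W^T.
Proof. by apply/matrixP => i j; rewrite !mxE rmorph_nat. Qed.

Lemma hubQ_sqn (x : 'rV_3) : sqn (x *m W *m A) = (x *m hubQ *m x^t*) 0 0.
Proof.
rewrite sqnE; congr (fun_of_matrix _ 0 0).
rewrite !trmx_mul !map_mxM (_ : A^t* = A) ?hubmx_tr_conj ?mulmxA //.
by apply/matrixP => i j; rewrite !mxE rmorph_nat es.
Qed.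

(** If the rows of [A] at [S] were dependent, orthogonality to them would cost at most two
    dimensions of the eigenspace of [N] for 1. The rest is fixed by [A], but the multiplicities of 1
    differ by three. *)
Lemma hubQ_neq0 (x : 'rV_3) : x != 0 -> x *m W *m A != 0.
Proof.
move=> x0; apply/negP => /eqP xWA.
have rkW : (\rank (A *m W^T) <= 2)%N.
  rewrite -mxrank_tr trmx_mul trmxK (adjm_tr es) -/A -ltnS ltn_neqAle rank_leq_row.
  rewrite andbT; apply: contra x0 => free.
  have : row_free (W *m A) by [].
  by move/row_free_inj/(_ x 0); rewrite mul0mx mulmxA xWA => ->.
pose K := (eigenspace N 1 :&: kermx (A *m W^T))%MS.
have rkK : (mult1 e S <= \rank K + 2)%N.
  rewrite /mult1 -/N -(mxrank_mul_ker (eigenspace N 1) (A *m W^T)) addnC leq_add2l.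
  exact: leq_trans (mxrankM_maxr _ _) rkW.
have : (\rank K <= mult1 e set0)%N.
  rewrite /mult1 del0; apply: mxrankS; apply/rV_subP => y; rewrite sub_capmx.
  case/andP => /eigenspaceP; rewrite scale1r => yN /sub_kermxP yA.
  apply/eigenspaceP; rewrite scale1r -/A [LHS](mulmx_split_hubs (y *m A)).
  rewrite -(mulmxA y A W^T) yA mul0mx addr0.
  have yP : y *m P = y by rewrite -yN -mulmxA NP.
  by rewrite -[RHS]yN /N delE !mulmxA yP.
have [_ mS _ _ _] := del_equality er A_int SP.1.
by rewrite S3 in mS; lia.
Qed.

Definition hubq (k l : 'I_3) : nat := \sum_u (e (hub k) u && e (hub l) u).

Lemma hubqC k l : hubq k l = hubq l k.
Proof. by apply: eq_bigr => u _; rewrite andbC. Qed.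

Lemma hubQE k l : hubQ k l = (hubq k l)%:R.
Proof.
rewrite hubmx_trE mxE natr_sum; apply: eq_bigr => u _.
by rewrite hubmxE !mxE -natrM mulnb (es u).
Qed.

Lemma hubQ_herm : hubQ \is hermsymmx.
Proof.
apply/is_hermitianmxP; rewrite expr0 scale1r; apply/matrixP => k l.
have -> (Q : 'M[algC]_3) : (Q^t*) k l = (Q l k)^* by rewrite !mxE.
by rewrite !hubQE hubqC rmorph_nat.
Qed.

Lemma hubq_le1 k l : k != l -> (hubq k l <= 1)%N.
Proof.
move=> kl; have [u /andP[ku lu]|none] := pickP (fun u => e (hub k) u && e (hub l) u).
  rewrite /hubq (bigD1 u) //= ku lu big1 // => v vu.
  case: (boolP (_ && _)) => // /andP[kv lv].
  have hkl : hub k != hub l by rewrite (inj_eq hub_inj).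
  by rewrite (rootable_common_nb er hkl kv lv ku lu) eqxx in vu.
by rewrite /hubq big1 // => u _; rewrite none.
Qed.

(** An eigenvalue [theta] of this Gram matrix is positive, [theta + 1] is the square of an integer
    by [hubQ_eigen], and a square above 1 is at least 4. *)
Lemma hubQ_spectrum k : exists z : int,
  4 <= z ^+ 2 /\ sdiag hubQ k = (z ^+ 2 - 1)%:~R.
Proof.
have /eigenvalueP[x xQ x0] : eigenvalue hubQ (sdiag hubQ k).
  by apply/(eigenvalue_spectral hubQ_herm); exists k.
have th_gt0 : 0 < sdiag hubQ k.
  have : 0 < sqn (x *m W *m A) by rewrite lt_def sqn_eq0 hubQ_neq0 ?sqn_ge0.
  by rewrite hubQ_sqn xQ -scalemxAl mxE -sqnE pmulr_lgt0 // lt_def sqn_eq0 x0 sqn_ge0.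
have /A_int/intrP[z zE] := hubQ_eigen x0 xQ th_gt0.
have z2 : sdiag hubQ k = (z ^+ 2 - 1)%:~R.
  by rewrite rmorphB rmorphXn /= -zE sqrtCK addrK.
exists z; split => //; move: th_gt0; rewrite z2 ltr0z expr2 => z_gt1.
have [[]|[]] : (z <= 1 /\ -1 <= z) \/ (2 <= z \/ z <= -2) by lia.
all: nia.
Qed.

Lemma three_hubs_absurd : False.
Proof.
have [z zP] := fin_all_exists hubQ_spectrum.
pose t k := z k ^+ 2 - 1; pose d k := Posz (hubq k k).
pose o1 : 'I_3 := lift ord0 ord0; pose o2 : 'I_3 := lift ord0 (lift ord0 ord0).
have ordP k : [\/ k = ord0, k = o1 | k = o2].
  by case: k => [[|[|[|]]] ki] //; [apply: Or31 | apply: Or32 | apply: Or33]; apply: val_inj.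
have tE k : (t k)%:~R = sdiag hubQ k by have [_ ->] := zP k.
have dE k : (d k)%:~R = hubQ k k by rewrite hubQE.
have sumE (f : 'I_3 -> int) (g : int -> int) :
    \sum_(x <- [seq f k | k <- enum 'I_3]) g x = \sum_k g (f k).
  by rewrite big_map big_enum.
pose E := (hubq ord0 o1 + hubq ord0 o2 + hubq o1 o2)%N.
apply: (@no_spectrum [seq d k | k <- enum 'I_3] [seq t k | k <- enum 'I_3] E).
- by rewrite size_map size_enum_ord.
- by rewrite size_map size_enum_ord.
- move=> _ _ /mapP[k _ ->] /mapP[l _ ->].
  by apply: square_gap5; [have [] := zP k | have [] := zP l].
- move=> _ /mapP[k _ ->].
  have [[j lej] [l lel]] := spectral_diag_entry_bounds hubQ_herm k.
  split; [exists (t l) | exists (t j)]; rewrite ?map_f ?mem_enum //.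
    by rewrite -(ler_int algC) tE dE.
  by rewrite -(ler_int algC) tE dE.
- have [s [u [v [sS uS su sv uv]]]] := hubs_common er A_int A_null SP S3 S_nbig.
  have [k ks] := hub_surj sS; have [l lu] := hub_surj uS; subst s u.
  have : (1 <= hubq k l)%N by rewrite /hubq (bigD1 v) //= sv uv.
  have := inj_eq hub_inj k l; rewrite (negPf su) => /esym/negbT kl.
  rewrite /E; case: (ordP k) kl => ->; case: (ordP l) => ->; rewrite ?eqxx //;
    rewrite ?(hubqC o1 ord0) ?(hubqC o2 ord0) ?(hubqC o2 o1); lia.
- have h1 := hubq_le1 (k := ord0) (l := o1) isT.
  have h2 := hubq_le1 (k := ord0) (l := o2) isT.
  have h3 := hubq_le1 (k := o1) (l := o2) isT.
  by rewrite /E; lia.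
- apply: (intr_inj (R := algC)); rewrite !(sumE _ id) !rmorph_sum /=.
  under eq_bigr do rewrite tE; rewrite -(spectral_trace hubQ_herm).
  by apply: eq_bigr => k _; rewrite dE.
apply: (intr_inj (R := algC)); rewrite rmorphD !(sumE _ (fun x => x * x)) !rmorph_sum /=.
under eq_bigr do rewrite rmorphM /= tE -expr2.
rewrite -(spectral_trace_sqr hubQ_herm) /mxtrace.
(* Off-diagonal entries are 0 or 1, so each pair contributes twice its entry to the trace of the
   square, in total [2 * E]. *)
have sq k l : k != l -> (hubq k l * hubq k l)%N = hubq k l.
  by move/hubq_le1; case: (hubq k l) => [|[|]].
have -> : \sum_k (hubQ *m hubQ) k k = (\sum_k \sum_l hubq k l * hubq k l)%:R.
  rewrite natr_sum; apply: eq_bigr => k _; rewrite mxE natr_sum.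
  by apply: eq_bigr => l _; rewrite !hubQE natrM (hubqC l).
rewrite !big_ord_recl !big_ord0 -/o1 -/o2 !addn0 !addr0.
rewrite -!rmorphM -!rmorphD /= -[(_)%:R]/((Posz _)%:~R); congr _%:~R.
rewrite (hubqC o1 ord0) (hubqC o2 ord0) (hubqC o2 o1).
rewrite (sq ord0 o1) // (sq ord0 o2) // (sq o1 o2) // /E /d.
lia.
Qed.

End HubMatrix.

(** * The star *)

Lemma integral_nullity3_cubic n (e : rel 'I_n) : rootable e ->
    (forall a, eigenvalue (adjm e) a -> a \is a Num.int) ->
    #|[set i | sdiag (adjm e) i == 0]| = 3%N ->
  n = 5%N /\ adjm e *m adjm e *m adjm e = 4 *: adjm e.
Proof.
move=> er A_int A_null; have [S SP] := exists_parter_set er.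
have [S0|S_gt0] := posnP #|S|.
  by apply: parter_set0 => //; rewrite -(cards0_eq S0).
have nE := parter_card er A_int A_null SP.
have n0 : (0 < n)%N by rewrite nE.
have [p [h H]] := er (Ordinal n0).
have m1 := parter_tops SP H; have bd := parter_bound er A_int A_null SP H.
(* The number of components, at least the multiplicity of 1, cancels. *)
have le3 : (nbig (del e S) + #|S| <= 3)%N by lia.
have [B0|B_gt0] := posnP (nbig (del e S)).
  have [S3 _] := parter_no_big er A_int A_null SP S_gt0 B0.
  have S3' : #|S| = 3%N by lia.
  by case: (three_hubs_absurd er A_int A_null SP S3' B0).
have [|i [j [ij BE _]]] := parter_big_pair er A_int SP; first by rewrite B_gt0; lia.
have B2 : nbig (del e S) = 2%N by rewrite /nbig BE cards2 ij.
by case: (no_parter_set1 er A_int A_null SP _ B2); lia.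
Qed.

(** A deepest vertex [v] is a leaf, with neighbour [u]. The walks of length three from [v] to [u]
    are as many as the neighbours of [u], so [u] has degree 4 among five vertices. *)
Lemma cubic_star n (e : rel 'I_n) : rootable e -> n = 5%N ->
  adjm e *m adjm e *m adjm e = 4 *: adjm e -> exists u, forall w, w != u -> e u w.
Proof.
move=> er n5 A3; have n0 : (0 < n)%N by rewrite n5.
have [p [h H]] := er (Ordinal n0); have [h0 hp ep] := H.
have [v _ vmax'] := @arg_maxnP _ (Ordinal n0) predT h isT.
have vmax w : (h w <= h v)%N by apply: vmax'.
have vr : v != Ordinal n0.
  apply/eqP => vr; have n1 : (1 < n)%N by rewrite n5.
  have := vmax (Ordinal n1); rewrite vr h0 leqn0 => /eqP h1.
  have : Ordinal n1 != Ordinal n0 by [].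
  by move/hp; rewrite h1.
exists (p v); set u := p v.
have vw w : e v w = (w == u).
  rewrite ep vr eq_sym; case: eqVneq => //= _; apply/negP => /andP[wr /eqP pw].
  by have := vmax w; rewrite (hp w wr) pw; lia.
have := A3 => /matrixP/(_ v u); rewrite -mulmxA [LHS]mxE [RHS]mxE.
rewrite (bigD1 u) //= big1 ?addr0 => [|w wu]; last by rewrite !mxE vw (negPf wu) mul0r.
rewrite !mxE vw eqxx mul1r mulr1.
under eq_bigr => w _ do rewrite !mxE (rootable_sym er w) -natrM mulnb andbb.
rewrite -natr_sum => /eqP; rewrite eqr_nat => /eqP deg4 w wu.
suff : w \in [set w | e u w] by rewrite inE.
suff -> : [set w | e u w] = [set~ u] by rewrite !inE.
apply/eqP; rewrite eqEcard; apply/andP; split.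
  by apply/subsetP => x; rewrite !inE; apply: contraTneq => ->; rewrite (rootable_irrefl er).
have n4 : n.-1 = 4%N by rewrite n5.
rewrite cardsC1 card_ord n4 -deg4 -sum1_card [leqRHS]big_mkcond leq_sum // => x _.
by rewrite inE; case: (e u x).
Qed.

Definition star_at (G : sgraph) (c : G) :=
  #|G| = 5%N /\ forall x y : G, adj x y = (x == c) (+) (y == c).

Lemma isomorphic_star (G : sgraph) :
  isomorphic G (complete_bipartite 1 4) <-> exists c : G, star_at c.
Proof.
split=> [[f f_bij f_adj]|[c [G5 G_adj]]].
  have [g fK gK] := f_bij; exists (g (inl ord0)); split.
    by rewrite (bij_eq_card f_bij) card_sum !card_ord.
  have isc x : (x == g (inl ord0)) = if f x is inl _ then true else false.
    apply/eqP/idP => [->|]; first by rewrite gK.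
    by case E: (f x) => [i|] // _; rewrite -(fK x) E (ord1 i).
  move=> x y; rewrite -f_adj !isc.
  by case: (f x) => i; case: (f y).
pose s := enum [set~ c].
have ss : size s = 4%N by rewrite -cardE cardsC1 G5.
have ms x : x != c -> x \in s by rewrite mem_enum !inE.
have ix x : x != c -> (index x s < 4)%N by move=> xc; rewrite -ss index_mem ms.
pose f (x : G) : complete_bipartite 1 4 :=
  if x == c then inl ord0 else inr (inord (index x s)).
have f_inj : injective f.
  move=> x y; rewrite /f; case: (eqVneq x c) => [->|xc]; case: (eqVneq y c) => [->|yc] //.
  case=> /(congr1 val); rewrite /= !inordK ?ix // => E.
  by rewrite -(nth_index c (ms x xc)) E nth_index ?ms.
exists f.
  by apply: inj_card_bij => //; rewrite G5 card_sum !card_ord.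
by move=> x y; rewrite G_adj /f; case: (x == c); case: (y == c).
Qed.

(** * The star is an integral tree of nullity 3 *)

Section Star.

Variables (G : sgraph) (c : G).
Hypothesis Gc : star_at c.

Lemma star_tree : is_tree G.
Proof.
have [G5 G_adj] := Gc; split; first split; first by rewrite G5.
  have xc x : connect (@adj G) x c.
    have [->|xc] := eqVneq x c; first exact: connect0.
    by apply: connect1; rewrite G_adj eqxx (negPf xc).
  move=> x y; apply: connect_trans (xc x) _.
  by rewrite (sym_connect_sym (@adj_sym G)).
(* Each edge of a cycle contains the centre, which occurs only once: impossible with three or more
   vertices. *)
case=> [|x [|y [|z s]]] //; rewrite /ucycle /= !inE !negb_or.
case/andP => /and3P[xy yz zs] /andP[/and3P[nxy nxz xs] /andP[/andP[nyz ys] _]].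
exfalso; move: xy yz zs; rewrite !G_adj.
have [xc|xc] := eqVneq x c.
  rewrite xc in nxy nxz; rewrite (eq_sym y) (negPf nxy) (eq_sym z) (negPf nxz) //.
have [yc|] //= := eqVneq y c; rewrite yc in nyz ys.
rewrite (eq_sym z) (negPf nyz) => _ _.
case: s xs ys => [|w s] /= xs ys.
  by rewrite andbT G_adj (eq_sym z) (negPf nyz) (negPf xc).
rewrite G_adj (eq_sym z) (negPf nyz) /= => /andP[/eqP wc _].
by rewrite wc inE eqxx in ys.
Qed.

Let e : rel 'I_#|G| := fun i j => adj (enum_val i) (enum_val j).

Let eE i j : e i j = (i == enum_rank c) (+) (j == enum_rank c).
Proof.
by rewrite /e Gc.2 -!(inj_eq enum_val_inj _ (enum_rank c)) enum_rankK.
Qed.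

Let o := enum_rank c.

Let G4 : #|G|.-1 = 4%N. Proof. by rewrite Gc.1. Qed.

(** For [a != 0], the values at the leaves are those at the centre divided by [a], and the equation
    at the centre gives [a ^+ 2 = 4]. *)
Lemma star_eigenvalue a : eigenvalue (adjacency_matrix G) a -> a = 0 \/ a ^+ 2 = 4.
Proof.
case/eigenvalueP => x xA x0; have [->|a0] := eqVneq a 0; [by left | right].
have leaf v : v != o -> x 0 o = a * x 0 v.
  move=> vo; have /rowP/(_ v) := xA; rewrite !mxE => <-.
  rewrite (bigD1 o) //= big1 ?addr0 => [|w wo]; last first.
    by rewrite mxE -/(e w v) eE (negPf wo) (negPf vo) mulr0.
  by rewrite mxE -/(e o v) eE eqxx (negPf vo) mulr1.
have center : \sum_(v | v != o) x 0 v = a * x 0 o.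
  have /rowP/(_ o) := xA; rewrite !mxE => <-.
  rewrite [RHS](bigD1 o) //= mxE -/(e o o) eE eqxx mulr0 add0r.
  by apply: eq_bigr => v vo; rewrite mxE -/(e v o) eE eqxx (negPf vo) mulr1.
have xo : x 0 o != 0.
  apply: contraNneq x0 => xo; apply/eqP/rowP => v; rewrite mxE.
  have [->//|/leaf/eqP] := eqVneq v o.
  by rewrite xo eq_sym mulf_eq0 (negPf a0) => /eqP.
apply: (mulIf xo); rewrite expr2 -mulrA -center mulr_sumr.
under eq_bigr => v vo do rewrite -leaf //.
by rewrite sumr_const cardC1 card_ord G4 mulr_natl.
Qed.

Lemma star_integral : integral_graph G.
Proof.
move=> a /star_eigenvalue[->|/eqP]; first exact: int_num0.
have -> : 4 = 2 ^+ 2 :> algC by rewrite -natrX.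
rewrite eqf_sqr => /orP[] /eqP ->.
  exact: (intr_int _ 2).
by rewrite rpredN (intr_int _ 2).
Qed.

(** The trace of the square is 8 and each nonzero eigenvalue contributes 4, so two of the five are
    nonzero. *)
Lemma star_nullity : nullity G = 3%N.
Proof.
have es : symmetric e by move=> i j; rewrite /e adj_sym.
have Ah := adjm_herm es.
rewrite /nullity (mup_char_poly_spectral Ah).
set Z := [set i | _]; have := spectral_trace_sqr Ah.
have -> : \tr (adjm e *m adjm e) = 8.
  have -> : 8 = (\sum_i \sum_j e i j)%:R :> algC.
    congr _%:R; rewrite (bigD1 o) //=.
    have -> : (\sum_j e o j = 4)%N.
      rewrite (eq_bigr (fun j => (j != o) : nat)) => [|j _]; last by rewrite eE eqxx.
      by rewrite -big_mkcond sum1_card cardC1 card_ord G4.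
    rewrite (eq_bigr (fun=> 1%N)) => [|i io].
      by rewrite sum1_card cardC1 card_ord G4.
    rewrite (bigD1 o) //= eE (negPf io) eqxx big1 // => j jo.
    by rewrite eE (negPf io) (negPf jo).
  rewrite natr_sum; apply: eq_bigr => i _; rewrite mxE natr_sum.
  by apply: eq_bigr => j _; rewrite !mxE (es j) -natrM mulnb andbb.
have dE i : spectral_diag (adjm e) 0 i ^+ 2 = (i \in ~: Z)%:R *+ 4.
  have /star_eigenvalue : eigenvalue (adjm e) (spectral_diag (adjm e) 0 i).
    by apply/(eigenvalue_spectral Ah); exists i.
  rewrite !inE; case: eqVneq => [->|d0 [d0'|->]]; rewrite ?expr0n ?mul0rn //.
  by rewrite d0' eqxx in d0.
under eq_bigr do rewrite dE.
rewrite sumrMnl -natr_sum -mulrnA => /eqP; rewrite eqr_nat.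
have -> : (\sum_i (i \in ~: Z) = #|~: Z|)%N.
  by rewrite -sum1_card [RHS]big_mkcond; apply: eq_bigr => i _; case: (i \in _).
have Z5 : (#|Z| + #|~: Z|)%N = 5%N by rewrite cardsC card_ord Gc.1.
by move/eqP; move: Z5; lia.
Qed.

End Star.

Theorem theorem4p6 (G : sgraph) :
  (is_tree G /\ integral_graph G /\ nullity G = 3%N) <->
  isomorphic G (complete_bipartite 1 4).
Proof.
rewrite isomorphic_star; split=> [[G_tree [G_int G_null]]|[c Gc]]; last first.
  by split; [exact: star_tree Gc | split; [exact: star_integral Gc | exact: star_nullity Gc]].
pose e : rel 'I_#|G| := fun i j => adj (enum_val i) (enum_val j).
have Gr := tree_rootable G_tree; have er : rootable e := rootable_enum Gr.
have A_null : #|[set i | sdiag (adjm e) i == 0]| = 3%N.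
  by rewrite -(mup_char_poly_spectral (adjm_herm (rootable_sym er))).
have [n5 A3] := integral_nullity3_cubic er G_int A_null.
have [u uP] := cubic_star er n5 A3.
have cP y : y != enum_val u -> adj (enum_val u) y.
  move=> yu; have := uP (enum_rank y).
  by rewrite /e -(inj_eq enum_val_inj) !enum_rankK; apply.
exists (enum_val u); split => // x y.
have [->|xc] := eqVneq x (enum_val u); have [->|yc] := eqVneq y (enum_val u).
- by rewrite adj_irrefl.
- exact: cP.
- by rewrite adj_sym; exact: cP.
(* An edge avoiding the centre would form a triangle with it. *)
by apply/negP => xy; apply: (rootable_triangle_free Gr (cP x xc) xy (cP y yc)).
Qed.
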